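(* Let $0\le\beta\le1$. Then $C_\beta[f]\in\mathcal{C}$ for every $f\in\mathcal{C}$.
   Context: $\mathbb{D}$ is the open unit disk; $\mathcal{A}$ the class of analytic $f$ on $\mathbb{D}$ with $f(0)=0$, $f'(0)=1$. $\mathcal{K}$ is the class of $f\in\mathcal{A}$ with $f'\neq0$ and $\mathrm{Re}\,(1+zf''(z)/f'(z))>0$ on $\mathbb{D}$ (normalized convex functions). $\mathcal{C}$ is the class of close-to-convex functions: $f\in\mathcal{A}$ such that $\mathrm{Re}\,(e^{i\alpha}f'(z)/g'(z))>0$ on $\mathbb{D}$ for some $g\in\mathcal{K}$ and some real $\alpha\in(-\pi/2,\pi/2)$. For $\beta\ge0$ and $f$ analytic on $\mathbb{D}$ with $f(0)=0$, $C_\beta[f](z)=\int_0^z \frac{f(w)}{w(1-w)^\beta}\,dw$ (principal branch of $(1-w)^\beta$). *)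

(* Defs.v *)
From HB Require Import structures.
From mathcomp Require Import all_boot all_order all_algebra.
From mathcomp Require Import all_classical all_reals all_analysis.
From mathcomp Require Import complex.
Import Order.TTheory GRing.Theory Num.Theory.
Import numFieldNormedType.Exports.
Local Open Scope ring_scope.
Local Open Scope complex_scope.

Set Implicit Arguments.
Unset Strict Implicit.
Unset Printing Implicit Defensive.

Section Defs.
Variable R : realType.

(* The complex plane, viewed as a normed module over itself, so that
   [derivable f z 1] / ['D_1 f z] are COMPLEX differentiability / derivative. *)
Notation C := (R[i])^o.

Definition ReC (z : R[i]) : R := complex.Re z.
Definition ImC (z : R[i]) : R := complex.Im z.
Definition modC (z : R[i]) : R := Num.sqrt (ReC z ^+ 2 + ImC z ^+ 2).

Definition in_disk (z : R[i]) : Prop := modC z < 1.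

Definition analytic_on_disk (f : C -> C) : Prop :=
  forall z : R[i], in_disk z -> derivable f z 1.

Definition cderiv (f : C -> C) : C -> C := fun z => 'D_1 f z.

Definition classA (f : C -> C) : Prop :=
  analytic_on_disk f /\ f 0 = 0 /\ cderiv f 0 = 1.

Definition classK (f : C -> C) : Prop :=
  classA f /\
  (forall z, in_disk z -> cderiv f z != 0) /\
  (forall z, in_disk z ->
     0 < ReC (1 + z * cderiv (cderiv f) z / cderiv f z)).

Definition expi (a : R) : R[i] := cos a +i* sin a.

Definition close_to_convex (f : C -> C) : Prop :=
  classA f /\
  exists g : C -> C, classK g /\
  exists alpha : R, - (pi / 2) < alpha < pi / 2 /\
    forall z, in_disk z -> 0 < ReC (expi alpha * cderiv f z / cderiv g z).

Definition Arg (u : R[i]) : R :=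
  let a := ReC u in let b := ImC u in
  if 0 < a then atan (b / a)
  else if a < 0 then (if 0 <= b then atan (b / a) + pi else atan (b / a) - pi)
  else if 0 < b then pi / 2
  else if b < 0 then - (pi / 2) else 0.

Definition cpow (u : R[i]) (beta : R) : R[i] :=
  if u == 0 then 0
  else ((modC u `^ beta)%:C * expi (beta * Arg u)).

(* F = C_beta[f] (z) = int_0^z f(w) / (w (1-w)^beta) dw on the disk:
   F is the (unique) analytic primitive on the (simply connected) disk
   vanishing at 0 of the integrand, whose singularity at w = 0 is removable. *)
Definition is_Cbeta (beta : R) (f F : C -> C) : Prop :=
  analytic_on_disk F /\ F 0 = 0 /\
  forall w : R[i], in_disk w -> w != 0 ->
    cderiv F w = f w / (w * cpow (1 - w) beta).

End Defs.

(* Main.v *)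
Require Import Defs.
From HB Require Import structures.
From mathcomp Require Import all_boot all_order all_algebra.
From mathcomp Require Import all_classical all_reals all_analysis.
From mathcomp Require Import complex ring lra.
Import Order.TTheory GRing.Theory Num.Theory.
Import numFieldNormedType.Exports.
Local Open Scope ring_scope.
Local Open Scope complex_scope.
Set Implicit Arguments.
Unset Strict Implicit.
Unset Printing Implicit Defensive.

(* Let [f] be close-to-convex with respect to the convex function [g] and the
   angle [alpha].  Marx and Strohhacker: [Re (z g'/g) > 1/2]; Libera:
   [Re (e^{i alpha} f/g) > 0].  Both follow by looking at a first point of the
   disk where the inequality degenerates.  The function [h] with
   [h' = (g/z)(1-z)^{-beta}] then satisfies
   [1 + z h''/h' = z g'/g + beta z/(1-z)], of real part greater than
   [1/2 - beta/2 >= 0], so [h] is convex, and [C_beta[f]'/h' = f/g].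

   Analyticity being mere complex differentiability, this rests on Goursat's
   theorem for rectangles with an exceptional point, which yields primitives on
   disks, hence Cauchy's formula (integrate the primitive of
   [(f(w) - f(z))/(w - z)] around a circle), the analyticity of derivatives,
   the removal of singularities and the maximum principle. *)

(** * Complex derivatives *)

(** The power [(1 - z)^beta] divides both [C_beta[f]'] and [h'], so the angle [alpha] serves every
    [beta], and all dependence on [beta] sits in the convexity of [h]. The margin is exhausted
    exactly at [beta = 1]: [z g'/g = 1/(1 - w)] with [|w| < 1] and [z/(1 - z) = 1/(1 - z) - 1], and
    [1/(1 - u)] sends the disk into the half-plane [Re > 1/2]. The bound [|w| < 1] also shows that
    [g/z] has no zero, which makes [f/g] and [h''/h'] meaningful; at the origin everything is
    expressed through the quotients [pf = f/z] and [p = g/z].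

    Integrals are differences of primitives on the whole real line. Additivity and orientation are
    then pure algebra, but integrands must be continuous on all of [R], so a function on a disk is
    first composed with a radial retraction. Estimates lose constant factors, which an arbitrary
    epsilon or an [n]-th root absorbs. The bisection behind Goursat's theorem is stated as a general
    compactness principle, because it also produces the first degenerate points. *)

Section RealDerivative.
Local Open Scope classical_set_scope.

(** Multiplying the difference quotient out by [h] covers [h = 0] as well. The generality in [K]
    serves both the real line and the complex plane. *)
Lemma is_derive1_epsP (K : numFieldType) (f : K -> K) (x l : K) :
  is_derive (x : K^o) (1 : K^o) (f : K^o -> K^o) (l : K^o) <->
  (forall e : K, 0 < e -> exists2 d : K, 0 < d &
     forall h, `|h| < d -> `|f (x + h) - f x - l * h| <= e * `|h|).
Proof.
split.
  move=> [fd <-] e e0.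
  have := fd; rewrite /derivable => /cvg_ex [l' fl'].
  have l'E : 'D_(1 : K^o) (f : K^o -> K^o) (x : K^o) = l' :> K.
    exact: (cvg_lim _ fl').
  move/cvgrPdist_lt : fl' => /(_ e e0).
  rewrite near_withinE /= => /nbhs_ballP [d /= d0 hd].
  exists d => // h hh; have [->|h0] := eqVneq h 0.
    by rewrite addr0 subrr mulr0 subr0 normr0 mulr0.
  have := hd h; rewrite /ball /= sub0r normrN => /(_ hh h0) /ltW.
  rewrite l'E /GRing.scale /= mulr1 (addrC h x) => H.
  have -> : f (x + h) - f x - l' * h = (h^-1 * (f (x + h) - f x) - l') * h.
    by field.
  by rewrite normrM distrC ler_pM2r // normr_gt0.
move=> H.
suff cv : (h^-1 *: ((f : K^o -> K^o) (h *: (1 : K^o) + x) - f x))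
    @[h --> (0:K)^'] --> (l : K^o).
  by apply: DeriveDef; [apply/cvg_ex; exists l | exact: cvg_lim cv].
apply/cvgrPdist_le => e e0; have [d d0 hd] := H e e0.
rewrite near_withinE /=; apply/nbhs_ballP; exists d => //= h.
rewrite /ball /= sub0r normrN => hh h0; have := hd h hh.
rewrite /GRing.scale /= mulr1 (addrC h x) => H1.
have -> : l - h^-1 * (f (x + h) - f x) = - (f (x + h) - f x - l * h) / h.
  by field.
by rewrite normrM normrN normfV ler_pdivrMr // normr_gt0.
Qed.

End RealDerivative.

(** * Modulus, and derivatives in epsilon-delta form with real quantifiers *)

Section Modulus.
Variable R : realType.
Implicit Types z w : R[i].
Local Notation C := (R[i])^o.

Lemma normCE z : `|z| = (modC z)%:C.
Proof. by rewrite normc_def. Qed.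

Lemma modC_ge0 z : 0 <= modC z.
Proof. exact: sqrtr_ge0. Qed.

Lemma modC_sqr z : modC z ^+ 2 = complex.Re z ^+ 2 + complex.Im z ^+ 2.
Proof. by rewrite sqr_sqrtr // addr_ge0 ?sqr_ge0. Qed.

Lemma modC0 : modC (0 : R[i]) = 0.
Proof. by apply: complexI; rewrite -normCE normr0. Qed.

Lemma modC1 : modC (1 : R[i]) = 1.
Proof. by apply: complexI; rewrite -normCE normr1. Qed.

Lemma modC_eq0 z : (modC z == 0) = (z == 0).
Proof. by rewrite -[RHS]normr_eq0 normCE -(inj_eq (@complexI R)). Qed.

Lemma modC_gt0 z : (0 < modC z) = (z != 0).
Proof. by rewrite lt_def modC_ge0 andbT modC_eq0. Qed.

Lemma modCM z w : modC (z * w) = modC z * modC w.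
Proof. by apply: complexI; rewrite rmorphM /= -!normCE normrM. Qed.

Lemma modCX z n : modC (z ^+ n) = modC z ^+ n.
Proof. by apply: complexI; rewrite rmorphXn /= -!normCE normrX. Qed.

Lemma modCV z : modC z^-1 = (modC z)^-1.
Proof. by apply: complexI; rewrite fmorphV /= -!normCE normfV. Qed.

Lemma modCN z : modC (- z) = modC z.
Proof. by apply: complexI; rewrite -!normCE normrN. Qed.

Lemma modCBC z w : modC (z - w) = modC (w - z).
Proof. by rewrite -modCN opprB. Qed.

Lemma modCD z w : modC (z + w) <= modC z + modC w.
Proof. by rewrite -lecR rmorphD /= -!normCE ler_normD. Qed.

Lemma modCB z w : modC (z - w) <= modC z + modC w.
Proof. by rewrite -(modCN w); exact: modCD. Qed.

Lemma modC_subl z w : modC z - modC w <= modC (z - w).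
Proof. by rewrite lerBlDr -[X in modC X <= _](subrK w); exact: modCD. Qed.

Lemma modC_real (x : R) : modC x%:C = `|x|.
Proof. by rewrite /modC /= expr0n addr0 sqrtr_sqr. Qed.

Lemma modC_nat (n : nat) : modC (n%:R : R[i]) = n%:R.
Proof. by rewrite -(rmorph_nat (real_complex R) n) modC_real ger0_norm ?ler0n. Qed.

Lemma modCi : modC ('i : R[i]) = 1.
Proof. by rewrite /modC /= expr0n add0r expr1n sqrtr1. Qed.

Lemma Re_le_modC z : `|complex.Re z| <= modC z.
Proof.
by rewrite -ler_sqr ?nnegrE ?modC_ge0 // modC_sqr real_normK ?num_real //
   lerDl sqr_ge0.
Qed.

Lemma Im_le_modC z : `|complex.Im z| <= modC z.
Proof.
by rewrite -ler_sqr ?nnegrE ?modC_ge0 // modC_sqr real_normK ?num_real //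
   lerDr sqr_ge0.
Qed.

Lemma modC_le_ReIm z : modC z <= `|complex.Re z| + `|complex.Im z|.
Proof.
rewrite [z in modC z]complexE (le_trans (modCD _ _)) //.
by rewrite modCM modCi mul1r !modC_real.
Qed.

Lemma ReD z w : complex.Re (z + w) = complex.Re z + complex.Re w.
Proof. by case: z; case: w. Qed.
Lemma ImD z w : complex.Im (z + w) = complex.Im z + complex.Im w.
Proof. by case: z; case: w. Qed.
Lemma ReN z : complex.Re (- z) = - complex.Re z. Proof. by case: z. Qed.
Lemma ImN z : complex.Im (- z) = - complex.Im z. Proof. by case: z. Qed.
Lemma ReM z w : complex.Re (z * w) =
  complex.Re z * complex.Re w - complex.Im z * complex.Im w.
Proof. by case: z; case: w. Qed.
Lemma ImM z w : complex.Im (z * w) =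
  complex.Re z * complex.Im w + complex.Im z * complex.Re w.
Proof. by case: z; case: w. Qed.
Definition ReImE := (ReD, ImD, ReN, ImN, ReM, ImM).

Lemma complex_ext z w :
  complex.Re z = complex.Re w -> complex.Im z = complex.Im w -> z = w.
Proof. by case: z; case: w => /= a b c d -> ->. Qed.

Lemma ltc0_real (e : R[i]) : 0 < e -> exists2 r : R, 0 < r & e = r%:C.
Proof.
case: e => a b; rewrite ltcE /= => /andP[/eqP -> a0]; exists a => //.
Qed.

(** Complex derivative as a relation between point and value, with [e] and [d] in [R], so that
    estimates live in a totally ordered field where [lra] applies. *)
Definition cder (f : R[i] -> R[i]) (z l : R[i]) := forall e : R, 0 < e ->
  exists2 d : R, 0 < d & forall h : R[i], modC h < d ->
    modC (f (z + h) - f z - l * h) <= e * modC h.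

Lemma is_derive_cderP (f : R[i] -> R[i]) (z l : R[i]) :
  is_derive (z : C) (1 : C) (f : C -> C) (l : C) <-> cder f z l.
Proof.
split.
  move=> /is_derive1_epsP H e e0.
  have /H [d d0 hd] : 0 < e%:C by rewrite ltcR.
  have [r r0 dr] := ltc0_real d0; exists r => // h.
  rewrite -ltcR -normCE -dr => /hd.
  by rewrite !normCE -rmorphM lecR.
move=> H; apply/is_derive1_epsP => e /ltc0_real [r r0 ->].
have [d d0 hd] := H r r0; exists d%:C; first by rewrite ltcR.
by move=> h; rewrite !normCE -rmorphM lecR ltcR => /hd.
Qed.

Lemma is_derive_realP (u : R -> R) (x l : R) :
  is_derive x 1 u l <-> forall e : R, 0 < e ->
  exists2 d : R, 0 < d & forall h : R, `|h| < d ->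
    `|u (x + h) - u x - l * h| <= e * `|h|.
Proof. exact: is_derive1_epsP. Qed.

Definition rder (phi : R -> R[i]) (t : R) (l : R[i]) := forall e : R, 0 < e ->
  exists2 d : R, 0 < d & forall s : R, `|s| < d ->
    modC (phi (t + s) - phi t - l * s%:C) <= e * `|s|.

Lemma rderP (phi : R -> R[i]) t l : rder phi t l <->
  is_derive t 1 (fun s => complex.Re (phi s)) (complex.Re l) /\
  is_derive t 1 (fun s => complex.Im (phi s)) (complex.Im l).
Proof.
have ReE s : complex.Re (phi (t + s) - phi t - l * s%:C) =
    complex.Re (phi (t + s)) - complex.Re (phi t) - complex.Re l * s.
  by rewrite !ReImE /= mulr0 subr0.
have ImE s : complex.Im (phi (t + s) - phi t - l * s%:C) =
    complex.Im (phi (t + s)) - complex.Im (phi t) - complex.Im l * s.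
  by rewrite !ReImE /= mulr0 add0r.
split=> [H|[/is_derive_realP Hr /is_derive_realP Hi] e e0].
  by split; apply/is_derive_realP => e e0; have [d d0 hd] := H e e0;
    exists d => // h /hd; apply: le_trans; rewrite -?ReE -?ImE ?Re_le_modC ?Im_le_modC.
have e20 : 0 < e / 2 by lra.
have [d1 d10 h1] := Hr _ e20; have [d2 d20 h2] := Hi _ e20.
exists (Num.min d1 d2); first by rewrite lt_min d10.
move=> s; rewrite lt_min => /andP[/h1 {}h1 /h2 {}h2].
rewrite (le_trans (modC_le_ReIm _)) // ReE ImE; lra.
Qed.

Lemma rder_comp (f : R[i] -> R[i]) (phi : R -> R[i]) t (l m : R[i]) :
  cder f (phi t) l -> rder phi t m ->
  rder (fun s => f (phi s)) t (l * m).
Proof.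
move=> Hf Hphi e e0.
(* Adding 1 keeps the constants positive, so that [e / 2] may be divided by them even when [m] or
   [l] is 0. *)
pose K := modC m + 1; have K0 : 0 < K by rewrite ltr_wpDl ?modC_ge0.
pose L := modC l + 1; have L0 : 0 < L by rewrite ltr_wpDl ?modC_ge0.
have [d d0 hd] : exists2 d : R, 0 < d & forall h : R[i], modC h < d ->
    modC (f (phi t + h) - f (phi t) - l * h) <= e / 2 / K * modC h.
  by apply: Hf; rewrite !divr_gt0.
have [d1 d10 h1] := Hphi 1 ltr01.
have [d2 d20 h2] : exists2 d : R, 0 < d & forall s : R, `|s| < d ->
    modC (phi (t + s) - phi t - m * s%:C) <= e / 2 / L * `|s|.
  by apply: Hphi; rewrite !divr_gt0.
exists (Num.min (Num.min d1 d2) (d / K)).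
  by rewrite !lt_min d10 d20 divr_gt0.
move=> s; rewrite !lt_min => /andP[/andP[/h1 {}h1 /h2 {}h2]].
rewrite ltr_pdivlMr // => sd.
set h := phi (t + s) - phi t in h1 h2 *.
have hK : modC h <= K * `|s|.
  have -> : h = (h - m * s%:C) + m * s%:C by rewrite subrK.
  rewrite (le_trans (modCD _ _)) // modCM modC_real /K mulrDl addrC lerD //.
have hlt : modC h < d by rewrite (le_lt_trans hK) // mulrC.
have := hd h hlt; have -> : phi t + h = phi (t + s) by rewrite addrC subrK.
move=> H1.
have -> : f (phi (t + s)) - f (phi t) - l * m * s%:C =
  (f (phi (t + s)) - f (phi t) - l * h) + l * (h - m * s%:C) by ring.
rewrite (le_trans (modCD _ _)) //.
have H2 : modC (f (phi (t + s)) - f (phi t) - l * h) <= e / 2 * `|s|.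
  rewrite (le_trans H1) // -mulrA ler_pM2l; last lra.
  by rewrite ler_pdivrMl.
have H3 : modC (l * (h - m * s%:C)) <= e / 2 * `|s|.
  rewrite modCM (@le_trans _ _ (L * (e / 2 / L * `|s|))) //.
    by rewrite ler_pM ?modC_ge0 // /L lerDl.
  by rewrite mulrA mulrCA divff ?mulr1 ?gt_eqF.
lra.
Qed.

End Modulus.

Lemma le_eq_trans (R : realType) (a b c : R) : b = a -> a <= c -> b <= c.
Proof. by move=> ->. Qed.

(** * Pointwise continuity of functions and of paths *)

Section Continuity.
Local Open Scope classical_set_scope.
Variable R : realType.
Local Notation C := (R[i])^o.

Implicit Types f g : R[i] -> R[i].

Definition ccont f (z : R[i]) := forall e : R, 0 < e ->
  exists2 d : R, 0 < d &
    forall h : R[i], modC h < d -> modC (f (z + h) - f z) < e.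

Definition rcont (phi : R -> R[i]) (t : R) := forall e : R, 0 < e ->
  exists2 d : R, 0 < d &
    forall s : R, `|s| < d -> modC (phi (t + s) - phi t) < e.

Lemma ccontP f (z : R[i]) : {for (z : C), continuous (f : C -> C)} <-> ccont f z.
Proof.
split.
  move=> /cvgrPdist_lt H e e0.
  have /H /nbhs_ballP[d /= /ltc0_real [r r0 ->] hd] : 0 < e%:C by rewrite ltcR.
  exists r => // h hr; have := hd (z + h).
  rewrite /ball /= opprD addNKr !normCE !ltcR modCN modCBC; exact.
move=> H; apply/(@cvgrPdist_lt _ C _ (nbhs (z : C))) => e /ltc0_real[r r0 ->].
have [d d0 hd] := H _ r0; apply/nbhs_ballP; exists d%:C => /=.
  by rewrite ltcR.
move=> w; rewrite /ball /= !normCE !ltcR modCBC => /hd.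
by rewrite (addrC z) subrK modCBC.
Qed.

Lemma continuous_Re : continuous (@complex.Re R : C -> R).
Proof.
move=> z; apply/(@cvgrPdist_lt _ R _ (nbhs (z : C))) => e e0; apply/nbhs_ballP; exists e%:C => /=.
  by rewrite ltcR.
move=> w; rewrite /ball /= normCE ltcR; apply: le_lt_trans.
by rewrite -ReN -ReD Re_le_modC.
Qed.

Lemma continuous_Im : continuous (@complex.Im R : C -> R).
Proof.
move=> z; apply/(@cvgrPdist_lt _ R _ (nbhs (z : C))) => e e0; apply/nbhs_ballP; exists e%:C => /=.
  by rewrite ltcR.
move=> w; rewrite /ball /= normCE ltcR; apply: le_lt_trans.
by rewrite -ImN -ImD Im_le_modC.
Qed.

Lemma continuous_RtoC : continuous (fun x : R => x%:C : C).
Proof.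
move=> x; apply/(@cvgrPdist_lt _ C _ (nbhs (x : R))) => e /ltc0_real[r r0 ->].
apply/nbhs_ballP; exists r => //= y; rewrite /ball /=.
by rewrite normCE ltcR -rmorphB modC_real.
Qed.

Lemma continuous_modC : continuous (@modC R : C -> R).
Proof.
move=> z; apply/(@cvgrPdist_lt _ R _ (nbhs (z : C))) => e e0; apply/nbhs_ballP; exists e%:C => /=.
  by rewrite ltcR.
move=> w; rewrite /ball /= normCE ltcR; apply: le_lt_trans.
rewrite ler_norml modC_subl andbT lerNl opprB modCBC.
exact: modC_subl.
Qed.

Lemma rcontP (phi : R -> R[i]) (t : R) :
  {for t, continuous (phi : R -> C)} <-> rcont phi t.
Proof.
split.
  move=> /cvgrPdist_lt H e e0.
  have /H /nbhs_ballP[d /= d0 hd] : 0 < e%:C by rewrite ltcR.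
  exists d => // h hr; have := hd (t + h).
  rewrite /ball /= opprD addNKr normrN => /(_ hr).
  by rewrite normCE ltcR modCBC.
move=> H; apply/(@cvgrPdist_lt _ C _ (nbhs (t : R))) => e /ltc0_real[r r0 ->].
have [d d0 hd] := H _ r0; apply/nbhs_ballP; exists d => //= w.
rewrite /ball /= distrC => /hd.
by rewrite (addrC t) subrK normCE ltcR modCBC.
Qed.

Lemma continuous_ReIm (T : topologicalType) (phi : T -> C) t :
  {for t, continuous (fun s => complex.Re (phi s))} ->
  {for t, continuous (fun s => complex.Im (phi s))} ->
  {for t, continuous phi}.
Proof.
move=> cr ci.
have -> : phi = (fun s => (complex.Re (phi s))%:C + 'i * (complex.Im (phi s))%:C).
  by apply/funext => s; exact: complexE.
apply: cvgD.
  exact: (continuous_comp cr (@continuous_RtoC _)).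
apply: cvgM; first exact: cvg_cst.
exact: (continuous_comp ci (@continuous_RtoC _)).
Qed.

Section ContinuityAlgebra.
Variables (T : topologicalType) (t : T).
Implicit Types phi psi : T -> R[i].
Local Notation cont phi := {for t, continuous (phi : T -> C)}.

Lemma contCD phi psi : cont phi -> cont psi -> cont (fun s => phi s + psi s).
Proof. move=> c1 c2; apply: cvgD; [exact: c1|exact: c2]. Qed.

Lemma contCB phi psi : cont phi -> cont psi -> cont (fun s => phi s - psi s).
Proof. move=> c1 c2; apply: cvgB; [exact: c1|exact: c2]. Qed.

Lemma contCM phi psi : cont phi -> cont psi -> cont (fun s => phi s * psi s).
Proof. move=> c1 c2; apply: cvgM; [exact: c1|exact: c2]. Qed.

Lemma contCV phi : cont phi -> phi t != 0 -> cont (fun s => (phi s)^-1).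
Proof. move=> c1 n0; apply: cvgV; [exact: n0|exact: c1]. Qed.

End ContinuityAlgebra.

Lemma rcontB (phi psi : R -> R[i]) t : rcont phi t -> rcont psi t ->
  rcont (fun s => phi s - psi s) t.
Proof. move=> /rcontP c1 /rcontP c2; apply/rcontP; exact (@contCB R t phi psi c1 c2). Qed.

Lemma rcontM (phi psi : R -> R[i]) t : rcont phi t -> rcont psi t ->
  rcont (fun s => phi s * psi s) t.
Proof. move=> /rcontP c1 /rcontP c2; apply/rcontP; exact (@contCM R t phi psi c1 c2). Qed.

Lemma rcontV (phi : R -> R[i]) t : rcont phi t -> phi t != 0 ->
  rcont (fun s => (phi s)^-1) t.
Proof. move=> /rcontP c1 n0; apply/rcontP; exact (@contCV R t phi c1 n0). Qed.

Lemma rcont_cst (k : R[i]) t : rcont (fun _ => k) t.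
Proof. by move=> e e0; exists 1 => // s _; rewrite subrr modC0. Qed.

Lemma ccontD (phi psi : R[i] -> R[i]) t : ccont phi t -> ccont psi t ->
  ccont (fun s => phi s + psi s) t.
Proof. move=> /ccontP c1 /ccontP c2; apply/ccontP; exact (@contCD C t phi psi c1 c2). Qed.

Lemma ccontB (phi psi : R[i] -> R[i]) t : ccont phi t -> ccont psi t ->
  ccont (fun s => phi s - psi s) t.
Proof. move=> /ccontP c1 /ccontP c2; apply/ccontP; exact (@contCB C t phi psi c1 c2). Qed.

Lemma ccontM (phi psi : R[i] -> R[i]) t : ccont phi t -> ccont psi t ->
  ccont (fun s => phi s * psi s) t.
Proof. move=> /ccontP c1 /ccontP c2; apply/ccontP; exact (@contCM C t phi psi c1 c2). Qed.

Lemma ccontV (phi : R[i] -> R[i]) t : ccont phi t -> phi t != 0 ->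
  ccont (fun s => (phi s)^-1) t.
Proof. move=> /ccontP c1 n0; apply/ccontP; exact (@contCV C t phi c1 n0). Qed.

Lemma ccont_cst (k : R[i]) t : ccont (fun _ => k) t.
Proof. by move=> e e0; exists 1 => // s _; rewrite subrr modC0. Qed.

Lemma ccont_id z : ccont id z.
Proof. by move=> e e0; exists e => // h; rewrite (addrC z) addrK. Qed.

Lemma ccont_comp f g z : ccont f z -> ccont g (f z) -> ccont (fun w => g (f w)) z.
Proof.
move=> /ccontP c1 /ccontP c2; apply/ccontP.
exact (@continuous_comp C C C f g z c1 c2).
Qed.

Lemma rcont_comp f (phi : R -> R[i]) t : rcont phi t -> ccont f (phi t) ->
  rcont (fun s => f (phi s)) t.
Proof.
move=> /rcontP c1 /ccontP c2; apply/rcontP.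
exact (@continuous_comp R C C phi f t c1 c2).
Qed.

Lemma rcont_ReIm (phi : R -> R[i]) t :
  {for t, continuous (fun s => complex.Re (phi s))} ->
  {for t, continuous (fun s => complex.Im (phi s))} -> rcont phi t.
Proof. move=> c1 c2; apply/rcontP; exact (@continuous_ReIm R phi t c1 c2). Qed.

Lemma cder_continuous f z l : cder f z l -> ccont f z.
Proof.
by move=> /is_derive_cderP[/derivable1_diffP/differentiable_continuous c _]; apply/ccontP.
Qed.

Lemma rder_continuous (phi : R -> R[i]) t l : rder phi t l -> rcont phi t.
Proof.
move=> /rderP[[/derivable1_diffP/differentiable_continuous cr _]
              [/derivable1_diffP/differentiable_continuous ci _]].
exact: rcont_ReIm.
Qed.

Lemma rderB (phi psi : R -> R[i]) t l m : rder phi t l -> rder psi t m ->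
  rder (fun s => phi s - psi s) t (l - m).
Proof.
move=> /rderP[r1 i1] /rderP[r2 i2]; apply/rderP; rewrite !ReImE; split.
  have -> : (fun s => complex.Re (phi s - psi s)) =
     (fun s => complex.Re (phi s)) - (fun s => complex.Re (psi s)).
    by apply/funext => s; rewrite !ReImE.
  exact: is_deriveB.
have -> : (fun s => complex.Im (phi s - psi s)) =
   (fun s => complex.Im (phi s)) - (fun s => complex.Im (psi s)).
  by apply/funext => s; rewrite !ReImE.
exact: is_deriveB.
Qed.

Lemma cder_linear (k z : R[i]) : cder (fun w => k * w) z k.
Proof.
move=> e e0; exists 1 => // h _.
have -> : k * (z + h) - k * z - k * h = 0 by ring.
by rewrite modC0 mulr_ge0 ?modC_ge0 // ltW.
Qed.

Lemma rderZ (phi : R -> R[i]) t l k : rder phi t l ->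
  rder (fun s => k * phi s) t (k * l).
Proof.
apply: (@rder_comp R (fun z => k * z) phi).
exact: cder_linear.
Qed.

Lemma rder_RtoC (t : R) : rder (fun s : R => s%:C) t 1.
Proof. by apply/rderP; split; [exact: is_derive_id|exact: is_derive_cst]. Qed.

Lemma rder_line (z : R[i]) (t : R) : rder (fun s : R => z * s%:C) t z.
Proof. by have := rderZ z (rder_RtoC t); rewrite mulr1. Qed.

End Continuity.

(** * Integrals along real intervals *)

Section Primitive.
Local Open Scope classical_set_scope.
Variable R : realType.
Local Notation C := (R[i])^o.
Local Notation mu := (@lebesgue_measure R).

Lemma integral_primitive (u : R -> R) (a x : R) : continuous u -> a < x ->
  is_derive x 1 (fun y => (\int[mu]_(t in `[a, y]) u t)%R) (u x).
Proof.
move=> cu ax.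
(* A two-sided derivative at [x] requires integrability on an interval reaching beyond [x]. *)
have xx1 : x < x + 1 by rewrite ltrDl.
have ui : mu.-integrable `[a, x + 1] (EFin \o u).
  apply: continuous_compact_integrable; first exact: segment_compact.
  exact: continuous_subspaceT.
have [d1 d2] := continuous_FTC1_closed xx1 ui ax (cu x).
by split; [exact: d1|rewrite -derive1E; exact: d2].
Qed.

(* The primitive is glued at 0 from the integral of [u] on the right and
   that of its reflection on the left. *)
Lemma ex_primitive (u : R -> R) : continuous u ->
  exists U : R -> R, forall x : R, is_derive x 1 U (u x).
Proof.
move=> cu.
(* With base point -1 on both sides, the two derivative formulas overlap on ]-1, 1[, so both hold at
   the gluing point 0. *)
pose U1 (y : R) := (\int[mu]_(t in `[-1, y]) u t)%R.
pose V (y : R) := (\int[mu]_(t in `[-1, y]) u (- t))%R.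
have dU1 (x : R) : -1 < x -> is_derive x 1 U1 (u x) by exact: integral_primitive.
have dU2 (x : R) : x < 1 -> is_derive x 1 (fun y => - V (- y)) (u x).
  move=> x1.
  have cv : continuous (fun t => u (- t)).
    move=> t; apply: (@continuous_comp _ _ _ (fun t : R => - t) u); last exact: cu.
    by apply: cvgN; exact: cvg_id.
  have dV : is_derive (- x) 1 V (u (- - x)).
    by apply: (@integral_primitive (fun t => u (- t))) => //; rewrite ltrN2.
  have dN : is_derive x (1 : R) (fun y : R => - y) (-1).
    exact: is_deriveNid.
  have := is_derive1_comp dV dN; rewrite opprK mulrN1 => dc.
  have := is_deriveN dc; rewrite opprK; exact.
(* The constants [U1 0] and [V 0] make both branches vanish at 0. *)
exists (fun x => if 0 <= x then U1 x - U1 0 else - V (- x) + V 0) => x.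
have [x0|x0|x0] := ltgtP x 0.
- apply/is_derive_realP => e e0.
  have /is_derive_realP/(_ e e0)[d d0 hd] := dU2 x (lt_trans x0 ltr01).
  exists (Num.min d (- x)); first by rewrite lt_min d0 oppr_gt0.
  move=> h; rewrite lt_min => /andP[hh hx]; have := hd h hh.
  have h0 : x + h < 0 by move: hx; rewrite ltr_norml => /andP[_]; lra.
  rewrite (leNgt 0 (x + h)) (leNgt 0 x) h0 x0 /=; apply: le_eq_trans; congr `|_|; ring.
- apply/is_derive_realP => e e0.
  have /is_derive_realP/(_ e e0)[d d0 hd] := dU1 x (lt_trans (ltrN10 R) x0).
  exists (Num.min d x); first by rewrite lt_min d0.
  move=> h; rewrite lt_min => /andP[hh hx]; have := hd h hh.
  have h0 : 0 < x + h by move: hx; rewrite ltr_norml => /andP[]; lra.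
  rewrite (ltW h0) (ltW x0) /=; apply: le_eq_trans; congr `|_|; ring.
- subst x; apply/is_derive_realP => e e0.
  have /is_derive_realP/(_ e e0)[d d0 hd] := dU1 0 (ltrN10 R).
  have /is_derive_realP/(_ e e0)[d' d'0 hd'] := dU2 0 ltr01.
  exists (Num.min d d'); first by rewrite lt_min d0.
  move=> h; rewrite lt_min => /andP[/hd h1 /hd'].
  rewrite lexx add0r in h1 *; case: (leP 0 h) => h0.
    move: h1 => + _; apply: le_eq_trans; congr `|_|; ring.
  apply: le_eq_trans; congr `|_|; rewrite oppr0; ring.
Qed.

(** A primitive picked by choice, with [cst 0] as a dummy value when none exists; only differences
    of its values matter. *)
Definition rprim (u : R -> R) : R -> R :=
  if pselect (exists U : R -> R, forall x : R, is_derive x 1 U (u x)) is left h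
  then sval (cid h) else cst 0.

Lemma rprimP (u : R -> R) : continuous u -> forall x : R, is_derive x 1 (rprim u) (u x).
Proof.
move=> /ex_primitive H; rewrite /rprim; case: pselect => // h.
exact: (svalP (cid h)).
Qed.

Definition cprim (phi : R -> R[i]) (t : R) : R[i] :=
  rprim (fun s => complex.Re (phi s)) t +i* rprim (fun s => complex.Im (phi s)) t.

(** Taking the integral to be an increment of a primitive makes splitting and reversing the interval
    instances of [ring], with no condition on [a], [b] or [phi]. *)
Definition cint (a b : R) (phi : R -> R[i]) : R[i] := cprim phi b - cprim phi a.

Lemma continuous_ReC (phi : R -> R[i]) : (forall t, rcont phi t) ->
  continuous (fun s => complex.Re (phi s)).
Proof. by move=> c t; have /rcontP ct := c t; exact: (continuous_comp ct (@continuous_Re _ _)). Qed.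

Lemma continuous_ImC (phi : R -> R[i]) : (forall t, rcont phi t) ->
  continuous (fun s => complex.Im (phi s)).
Proof. by move=> c t; have /rcontP ct := c t; exact: (continuous_comp ct (@continuous_Im _ _)). Qed.

Lemma cprimP (phi : R -> R[i]) : (forall t, rcont phi t) -> forall t, rder (cprim phi) t (phi t).
Proof.
move=> c t; apply/rderP; split; apply: rprimP.
  exact: continuous_ReC.
exact: continuous_ImC.
Qed.

Lemma rder_eq_cst (Phi Psi : R -> R[i]) (phi : R -> R[i]) a b :
  (forall t, rder Phi t (phi t)) -> (forall t, rder Psi t (phi t)) ->
  Phi b - Phi a = Psi b - Psi a.
Proof.
move=> H1 H2.
have H t := rderB (H1 t) (H2 t).
have : Phi b - Psi b = Phi a - Psi a.
  apply: complex_ext.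
    apply: (@is_derive_0_is_cst _ (fun t => complex.Re (Phi t - Psi t))) => x.
    by have /rderP[+ _] := H x; rewrite subrr.
  apply: (@is_derive_0_is_cst _ (fun t => complex.Im (Phi t - Psi t))) => x.
  by have /rderP[_ +] := H x; rewrite subrr.
move=> E; apply/eqP; rewrite -subr_eq0; apply/eqP.
transitivity ((Phi b - Psi b) - (Phi a - Psi a)); first by ring.
by rewrite E subrr.
Qed.

Lemma cint_FTC (phi Phi : R -> R[i]) a b : (forall t, rcont phi t) ->
  (forall t, rder Phi t (phi t)) -> cint a b phi = Phi b - Phi a.
Proof. by move=> /cprimP c H; exact: rder_eq_cst c H. Qed.

Lemma cintB (phi psi : R -> R[i]) a b : (forall t, rcont phi t) -> (forall t, rcont psi t) ->
  cint a b (fun t => phi t - psi t) = cint a b phi - cint a b psi.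
Proof.
move=> c1 c2; rewrite (@cint_FTC _ (fun t => cprim phi t - cprim psi t)).
- by rewrite /cint; ring.
- by move=> t; exact: rcontB.
- by move=> t; apply: rderB; exact: cprimP.
Qed.

Lemma cintZ (phi : R -> R[i]) k a b : (forall t, rcont phi t) ->
  cint a b (fun t => k * phi t) = k * cint a b phi.
Proof.
move=> c; rewrite (@cint_FTC _ (fun t => k * cprim phi t)).
- by rewrite /cint; ring.
- by move=> t; apply: rcontM => //; exact: rcont_cst.
- by move=> t; apply: rderZ; exact: cprimP.
Qed.

(** The mean value theorem holds for real functions only, so it is applied to the real and imaginary
    parts separately; this is the origin of the factor 2. *)
Lemma cint_bound (phi : R -> R[i]) a b M : (forall t, rcont phi t) ->
  (forall t, Num.min a b <= t <= Num.max a b -> modC (phi t) <= M) ->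
  modC (cint a b phi) <= 2 * M * `|b - a|.
Proof.
move=> c; wlog ab : a b / a <= b.
  move=> H HM; have [|/ltW] := leP a b; first by move=> /H; apply.
  move=> /H; rewrite minC maxC => /(_ HM).
  by rewrite distrC /cint modCBC.
rewrite min_l // max_r // => HM.
have MV (u : R -> R) : continuous u -> (forall t, a <= t <= b -> `|u t| <= M) ->
    `|rprim u b - rprim u a| <= M * `|b - a|.
  move=> cu Hu.
  have [| |x xab ->] := @MVT_segment R (rprim u) u a b ab.
  - by move=> x _; exact: rprimP.
  - apply: derivable_within_continuous => x _.
    by have [] := rprimP cu x.
  by rewrite normrM ler_wpM2r // Hu.
rewrite (le_trans (modC_le_ReIm _)) //= -mulrA mulr2n mulrDl mul1r lerD //; apply: MV.
- exact: continuous_ReC.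
- by move=> t /HM; apply: le_trans; exact: Re_le_modC.
- exact: continuous_ImC.
- by move=> t /HM; apply: le_trans; exact: Im_le_modC.
Qed.

End Primitive.

(** * Goursat's theorem *)

Section Bisection.
Local Open Scope classical_set_scope.
Variable R : realType.

Lemma nested_intervals (a b : nat -> R) :
  (forall n, a n <= a n.+1) -> (forall n, b n.+1 <= b n) ->
  (forall n, a n <= b n) -> exists x, forall n, a n <= x <= b n.
Proof.
move=> ha hb hab.
have ha' m n : (m <= n)%N -> a m <= a n.
  elim: n => [|n IH]; first by rewrite leqn0 => /eqP->.
  rewrite leq_eqVlt => /orP[/eqP->//|]; rewrite ltnS => /IH h.
  exact: le_trans h _.
have hb' m n : (m <= n)%N -> b n <= b m.
  elim: n => [|n IH]; first by rewrite leqn0 => /eqP->.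
  rewrite leq_eqVlt => /orP[/eqP->//|]; rewrite ltnS => /IH h.
  exact: le_trans h.
have hmn m n : a m <= b n.
  by have [/ha' h|/ltnW/hb' h] := leqP m n; [exact: le_trans h _|exact: le_trans h].
exists (sup (range a)) => n; apply/andP; split.
  apply: ub_le_sup; last by exists n.
  by exists (b 0%N) => _ [m _ <-].
by apply: ge_sup; [exists (a 0%N), 0%N|move=> _ [m _ <-]].
Qed.

Lemma ex_half_pow_lt (W d : R) : 0 < d -> exists n, W / 2 ^+ n < d.
Proof.
move=> d0.
exists (Num.bound (`|W| / d)).
rewrite ltr_pdivrMr ?exprn_gt0 // mulrC -ltr_pdivrMr //.
have H : `|W| / d < (Num.bound (`|W| / d))%:R.
  by apply: archi_boundP; rewrite divr_ge0 // ltW.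
apply: (@le_lt_trans _ _ (`|W| / d)); first by rewrite ler_pM2r ?invr_gt0 // ler_norm.
apply: (lt_le_trans H); rewrite -natrX ler_nat ltnW //.
exact: ltn_expl.
Qed.

Variable P : R -> R -> R -> R -> Prop.

(** Selects a quarter on which [P] fails. The last quarter needs no test: if the other three satisfy
    [P], the gluing hypothesis forces it to fail. *)
Let step (q : R * R * R * R) : R * R * R * R :=
  let: (a, b, c, d) := q in
  let m := (a + b) / 2 in let n := (c + d) / 2 in
  if ~~ `[< P a m c n >] then (a, m, c, n)
  else if ~~ `[< P m b c n >] then (m, b, c, n)
  else if ~~ `[< P a m n d >] then (a, m, n, d)
  else (m, b, n, d).

(** Compactness of a rectangle as an induction principle: a failure of [P] is inherited by one
    quarter forever, and the nested quarters shrink to a point where the local hypothesis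
    contradicts it. *)
Lemma quadrisection (a b c d : R) : a <= b -> c <= d ->
  (forall a b c d, a <= b -> c <= d ->
    P a ((a + b) / 2) c ((c + d) / 2) -> P ((a + b) / 2) b c ((c + d) / 2) ->
    P a ((a + b) / 2) ((c + d) / 2) d -> P ((a + b) / 2) b ((c + d) / 2) d ->
    P a b c d) ->
  (forall x y, a <= x <= b -> c <= y <= d -> exists2 e : R, 0 < e &
    forall a' b' c' d', a <= a' <= x -> x <= b' <= b -> c <= c' <= y ->
      y <= d' <= d -> (b' - a') + (d' - c') < e -> P a' b' c' d') ->
  P a b c d.
Proof.
move=> ab cd Psplit Ploc; apply: contrapT => NP.
pose q n := iter n step (a, b, c, d).
pose qa n := (q n).1.1.1; pose qb n := (q n).1.1.2.
pose qc n := (q n).1.2; pose qd n := (q n).2.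
have qE n : q n = (qa n, qb n, qc n, qd n).
  by rewrite /qa /qb /qc /qd; case: (q n) => [[[]]].
have inv n : [/\ qa n <= qb n, qc n <= qd n,
    (qb n - qa n = (b - a) / 2 ^+ n), (qd n - qc n = (d - c) / 2 ^+ n) &
    ~ P (qa n) (qb n) (qc n) (qd n)].
  elim: n => [|n [h1 h2 h3 h4 h5]].
    by rewrite /qa /qb /qc /qd /= expr0 !divr1.
  have e3 : (b - a) / 2 ^+ n.+1 = (qb n - qa n) / 2.
    by rewrite h3 exprS invfM; ring.
  have e4 : (d - c) / 2 ^+ n.+1 = (qd n - qc n) / 2.
    by rewrite h4 exprS invfM; ring.
  rewrite e3 e4.
  have := erefl (q n.+1); rewrite {2}/q iterS -/(q n) qE (qE n) /step.
  case: asboolP => p1 /=; last by move=> [-> -> -> ->]; split => //; lra.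
  case: asboolP => p2 /=; last by move=> [-> -> -> ->]; split => //; lra.
  case: asboolP => p3 /=; last by move=> [-> -> -> ->]; split => //; lra.
  move=> [-> -> -> ->]; split => //; try lra.
  by move=> p4; apply: h5; apply: Psplit.
have mono n : [/\ qa n <= qa n.+1, qb n.+1 <= qb n, qc n <= qc n.+1 &
    qd n.+1 <= qd n].
  have [h1 h2 _ _ _] := inv n.
  have := erefl (q n.+1); rewrite {2}/q iterS -/(q n) qE (qE n) /step.
  by do 3?case: ifP => _; move=> [-> -> -> ->]; split=> //; lra.
have [x hx] : exists x, forall n, qa n <= x <= qb n.
  by apply: nested_intervals => n; [case: (mono n)|case: (mono n)|case: (inv n)].
have [y hy] : exists y, forall n, qc n <= y <= qd n.
  by apply: nested_intervals => n; [case: (mono n)|case: (mono n)|case: (inv n)].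
have bnd n : [/\ a <= qa n, qb n <= b, c <= qc n & qd n <= d].
  elim: n => [|n [h1 h2 h3 h4]]; first by rewrite /qa /qb /qc /qd /=.
  have [k1 k2 k3 k4] := mono n; split; lra.
have [e e0 he] := Ploc x y (hx 0%N) (hy 0%N).
have [n hn] := ex_half_pow_lt ((b - a) + (d - c)) e0.
have [_ _ w1 w2] := inv n; apply.
have [k1 k2 k3 k4] := bnd n; have /andP[x1 x2] := hx n; have /andP[y1 y2] := hy n.
apply: he; rewrite ?k1 ?k2 ?k3 ?k4 ?x1 ?x2 ?y1 ?y2 //.
by rewrite w1 w2 -mulrDl.
Qed.

End Bisection.

(** * Integrals over the boundary of a rectangle *)

Section Rectangle.
Variable R : realType.
Local Notation C := (R[i])^o.
Implicit Types f g : R[i] -> R[i].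

Definition cdiff f z := exists l, cder f z l.

Definition hor f y a b : R[i] := cint a b (fun t => f (t +i* y)).
Definition ver f x c d : R[i] := cint c d (fun s => f (x +i* s)).
(** The boundary run counterclockwise: bottom, right, then top and left backwards; ['i] is the
    velocity on vertical sides. *)
Definition rect f a b c d : R[i] :=
  hor f c a b + 'i * ver f b c d - hor f d a b - 'i * ver f a c d.

Lemma continuous_hor f y : (forall z, ccont f z) ->
  forall t, rcont (fun t : R => f (t +i* y)) t.
Proof.
move=> cf t; apply: (@rcont_comp R f (fun t : R => t +i* y)) => //.
by apply: rcont_ReIm; [exact: cvg_id|exact: cvg_cst].
Qed.

Lemma continuous_ver f x : (forall z, ccont f z) ->
  forall t, rcont (fun s : R => f (x +i* s)) t.
Proof.
move=> cf t; apply: (@rcont_comp R f (fun t : R => x +i* t)) => //.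
by apply: rcont_ReIm; [exact: cvg_cst|exact: cvg_id].
Qed.

Lemma rectB f g a b c d : (forall z, ccont f z) -> (forall z, ccont g z) ->
  rect (fun z => f z - g z) a b c d = rect f a b c d - rect g a b c d.
Proof.
move=> cf cg; rewrite /rect /hor /ver.
rewrite !cintB; try exact: continuous_hor; try exact: continuous_ver.
by ring.
Qed.

Lemma hor_primitive f F y a b : (forall z, ccont f z) ->
  (forall z, cder F z (f z)) ->
  hor f y a b = F (b +i* y) - F (a +i* y).
Proof.
move=> cf dF; rewrite /hor (@cint_FTC _ _ (fun t => F (t +i* y))) //.
  exact: continuous_hor.
move=> t; rewrite -[f _]mulr1; apply: (@rder_comp R F (fun t => t +i* y)) => //.
apply/rderP; split; first exact: is_derive_id.
exact: is_derive_cst.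
Qed.

Lemma ver_primitive f F x c d : (forall z, ccont f z) ->
  (forall z, cder F z (f z)) ->
  'i * ver f x c d = F (x +i* d) - F (x +i* c).
Proof.
move=> cf dF; rewrite /ver -cintZ; last exact: continuous_ver.
rewrite (@cint_FTC _ _ (fun t => F (x +i* t))) //.
  by move=> t; apply: rcontM; [exact: rcont_cst|exact: continuous_ver].
move=> t; rewrite mulrC; apply: (@rder_comp R F (fun t => x +i* t)) => //.
apply/rderP; split; first exact: is_derive_cst.
exact: is_derive_id.
Qed.

Lemma rect_primitive f F a b c d : (forall z, ccont f z) ->
  (forall z, cder F z (f z)) -> rect f a b c d = 0.
Proof.
move=> cf dF; rewrite /rect !(hor_primitive _ _ _ cf dF) !(ver_primitive _ _ _ cf dF).
by ring.
Qed.

(** The first-order Taylor polynomial at [z0] has a primitive, so subtracting it from [f] leaves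
    boundary integrals unchanged. *)
Lemma affine_primitive (p l z0 z : R[i]) :
  cder (fun z => p * z + l / 2 * ((z - z0) * (z - z0))) z (p + l * (z - z0)).
Proof.
move=> e e0; pose K := modC (l / 2) + 1.
have K0 : 0 < K by rewrite ltr_wpDl ?modC_ge0.
exists (e / K); first by rewrite divr_gt0.
move=> h hK.
have -> : p * (z + h) + l / 2 * ((z + h - z0) * (z + h - z0)) -
  (p * z + l / 2 * ((z - z0) * (z - z0))) - (p + l * (z - z0)) * h =
  l / 2 * h * h by field.
rewrite !modCM ler_wpM2r ?modC_ge0 //.
have := ltW hK; rewrite ler_pdivlMr // mulrC; apply: le_trans.
by rewrite -modCM ler_wpM2r ?modC_ge0 // /K modCM lerDl.
Qed.

Lemma affine_continuous (p l z0 z : R[i]) : ccont (fun z => p + l * (z - z0)) z.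
Proof.
apply: ccontD; first exact: ccont_cst.
apply: ccontM; first exact: ccont_cst.
by apply: ccontB; [exact: ccont_id|exact: ccont_cst].
Qed.

Lemma rect_bound f (a b c d M : R) : (forall z, ccont f z) -> a <= b -> c <= d ->
  (forall x y, a <= x <= b -> c <= y <= d -> modC (f (x +i* y)) <= M) ->
  modC (rect f a b c d) <= 4 * M * ((b - a) + (d - c)).
Proof.
move=> cf ab cd HM.
have hb y : c <= y <= d -> modC (hor f y a b) <= 2 * M * (b - a).
  move=> hy; rewrite -[b - a]ger0_norm ?subr_ge0 //.
  apply: cint_bound; first exact: continuous_hor.
  by move=> t; rewrite min_l // max_r // => ht; exact: HM.
have vb x : a <= x <= b -> modC (ver f x c d) <= 2 * M * (d - c).
  move=> hx; rewrite -[d - c]ger0_norm ?subr_ge0 //.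
  apply: cint_bound; first exact: continuous_ver.
  by move=> t; rewrite min_l // max_r // => ht; exact: HM.
have h1 := hb c; have h2 := hb d; have h3 := vb a; have h4 := vb b.
rewrite !lexx /= ab cd in h1 h2 h3 h4.
have {}h1 := h1 isT; have {}h2 := h2 isT; have {}h3 := h3 isT; have {}h4 := h4 isT.
rewrite /rect (le_trans (modCB _ _)) // modCM modCi mul1r.
have := modCB (hor f c a b + 'i * ver f b c d) (hor f d a b).
have := modCD (hor f c a b) ('i * ver f b c d).
rewrite modCM modCi mul1r; lra.
Qed.

(* The side sum squared, unlike the area, controls the perimeter times the
   diameter, and it is still exactly additive under quadrisection. *)
Lemma rect_small f (z0 : R[i]) (e : R) : (forall z, ccont f z) ->
  cdiff f z0 -> 0 < e ->
  exists2 dl : R, 0 < dl & forall a b c d,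
    a <= complex.Re z0 <= b -> c <= complex.Im z0 <= d ->
    (b - a) + (d - c) < dl ->
    modC (rect f a b c d) <= e * ((b - a) + (d - c)) ^+ 2.
Proof.
move=> cf [l df] e0.
(* The 4 cancels the constant of [rect_bound]. *)
have /df [dl dl0 hdl] : 0 < e / 4 by lra.
exists dl => // a b c d /andP[a1 b1] /andP[c1 d1] hw.
pose g := (fun z => f z0 + l * (z - z0)).
have cg z : ccont g z by exact: affine_continuous.
have rg : rect g a b c d = 0.
  apply: (rect_primitive a b c d cg) => z; exact: affine_primitive.
rewrite -[rect f a b c d]subr0 -rg -rectB //.
have ab : a <= b by lra. have cd : c <= d by lra.
rewrite (@le_trans _ _ (4 * (e / 4 * ((b - a) + (d - c))) * ((b - a) + (d - c)))) //;
  last by rewrite le_eqVlt; apply/orP; left; apply/eqP; field.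
apply: rect_bound => //.
  by move=> z; exact: ccontB.
move=> x y /andP[x1 x2] /andP[y1 y2].
set z := x +i* y; pose h := z - z0.
have hh : modC h <= (b - a) + (d - c).
  rewrite (le_trans (modC_le_ReIm _)) // /h !ReImE /= lerD //.
    by rewrite ler_norml; apply/andP; split; lra.
  by rewrite ler_norml; apply/andP; split; lra.
have := hdl h (le_lt_trans hh hw).
rewrite (addrC z0) subrK /g opprD addrA => /le_trans; apply.
by rewrite ler_pM2l // divr_gt0.
Qed.

(** Inner edges cancel in pairs. As an identity between values of primitives it holds for any
    cutting point [(m, n)], even one outside. *)
Lemma rect_quad f (a b c d m n : R) : rect f a b c d =
  rect f a m c n + rect f m b c n + rect f a m n d + rect f m b n d.
Proof. rewrite /rect /hor /ver /cint; ring. Qed.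

Lemma goursat f (a b c d : R) : (forall z, ccont f z) -> a <= b -> c <= d ->
  (forall x y, a <= x <= b -> c <= y <= d -> cdiff f (x +i* y)) ->
  rect f a b c d = 0.
Proof.
move=> cf ab cd df.
have H e : 0 < e -> modC (rect f a b c d) <= e * ((b - a) + (d - c)) ^+ 2.
  move=> e0; move: ab cd.
  pose P a b c d := modC (rect f a b c d) <= e * ((b - a) + (d - c)) ^+ 2.
  move=> ab cd; apply: (@quadrisection _ P) => //.
    move=> {ab cd df}a {}b {}c {}d ab cd; rewrite /P (rect_quad _ a b c d ((a + b) / 2) ((c + d) / 2)).
    set r1 := rect _ _ _ _ _; set r2 := rect _ _ _ _ _.
    set r3 := rect _ _ _ _ _; set r4 := rect _ _ _ _ _ => h1 h2 h3 h4.
    have := modCD (r1 + r2 + r3) r4; have := modCD (r1 + r2) r3.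
    have := modCD r1 r2; set W := b - a + (d - c).
    have w1 : (a + b) / 2 - a + ((c + d) / 2 - c) = W / 2 by rewrite /W; field.
    have w2 : b - (a + b) / 2 + ((c + d) / 2 - c) = W / 2 by rewrite /W; field.
    have w3 : (a + b) / 2 - a + (d - (c + d) / 2) = W / 2 by rewrite /W; field.
    have w4 : b - (a + b) / 2 + (d - (c + d) / 2) = W / 2 by rewrite /W; field.
    rewrite w1 in h1; rewrite w2 in h2; rewrite w3 in h3; rewrite w4 in h4.
    have -> : e * W ^+ 2 = 4 * (e * (W / 2) ^+ 2) by field.
    lra.
  move=> x y hx hy; have [dl dl0 hdl] := rect_small cf (df x y hx hy) e0.
  by exists dl => // a' b' c' d' /andP[_ h1] /andP[h2 _] /andP[_ h3] /andP[h4 _];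
    apply: hdl; rewrite /= ?h1 ?h2 ?h3 ?h4.
apply/eqP; rewrite -modC_eq0 eq_le modC_ge0 andbT.
apply/ler_addgt0Pl => e e0; rewrite addr0.
(* The added 1 avoids dividing by zero when the rectangle is a point. *)
pose W := ((b - a) + (d - c)) ^+ 2 + 1.
have W0 : 0 < W by rewrite ltr_wpDl ?sqr_ge0.
have := H (e / W) (divr_gt0 e0 W0) => /le_trans; apply.
by rewrite mulrAC ler_pdivrMr // ler_pM2l // /W lerDl.
Qed.

Lemma rect_splitx f (a b c d m : R) :
  rect f a b c d = rect f a m c d + rect f m b c d.
Proof. rewrite /rect /hor /ver /cint; ring. Qed.

Lemma rect_splity f (a b c d n : R) :
  rect f a b c d = rect f a b c n + rect f a b n d.
Proof. rewrite /rect /hor /ver /cint; ring. Qed.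

Lemma rect0x f (a c d : R) : rect f a a c d = 0.
Proof. rewrite /rect /hor /ver /cint; ring. Qed.

Lemma rect0y f (a b c : R) : rect f a b c c = 0.
Proof. rewrite /rect /hor /ver /cint; ring. Qed.

Lemma rectNx f (a b c d : R) : rect f b a c d = - rect f a b c d.
Proof. rewrite /rect /hor /ver /cint; ring. Qed.

Lemma rectNy f (a b c d : R) : rect f a b d c = - rect f a b c d.
Proof. rewrite /rect /hor /ver /cint; ring. Qed.

(** Everything except a tiny rectangle around [z0] is cut off by Goursat's theorem; on that
    rectangle continuity bounds [f], so its boundary integral is as small as its perimeter. *)
Lemma goursat_except f (z0 : R[i]) (a b c d : R) : (forall z, ccont f z) -> a <= b -> c <= d ->
  (forall x y, a <= x <= b -> c <= y <= d -> x +i* y != z0 ->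
     cdiff f (x +i* y)) ->
  rect f a b c d = 0.
Proof.
case: z0 => p q cf ab cd df.
have sub a' b' c' d' : a <= a' -> a' <= b' -> b' <= b -> c <= c' -> c' <= d' ->
    d' <= d -> [|| p < a', b' < p, q < c' | d' < q] -> rect f a' b' c' d' = 0.
  move=> h1 h2 h3 h4 h5 h6 h7; apply: goursat => // x y /andP[x1 x2] /andP[y1 y2].
  apply: df; first by apply/andP; split; lra.
    by apply/andP; split; lra.
  rewrite eq_complex /=; apply/negP => /andP[/eqP E1 /eqP E2].
  by move: h7; rewrite -E1 -E2 => /or4P[]; lra.
have [/andP[/andP[h1 h2] /andP[h3 h4]]|] :=
    boolP ((a <= p <= b) && (c <= q <= d)); last first.
  rewrite !negb_and -!ltNge => H; apply: sub => //.
  by case/orP: H => /orP[] ->; rewrite ?orbT.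
apply/eqP; rewrite -modC_eq0 eq_le modC_ge0 andbT.
apply/ler_addgt0Pl => e e0; rewrite addr0.
have /(_ 1 ltr01) [dl dl0 hdl] := cf (p +i* q).
pose M := modC (f (p +i* q)) + 1.
have M0 : 0 < M by rewrite ltr_wpDl ?modC_ge0.
(* [dl / 4] keeps the small rectangle where [f] is bounded by [M]; [16 * M] is the 4 of [rect_bound]
   times [M] times the side sum, which is at most [4 * t]. *)
pose t := Num.min (dl / 4) (e / (16 * M)).
have t0 : 0 < t by rewrite lt_min !divr_gt0 // mulr_gt0.
have td : t <= dl / 4 by rewrite ge_min lexx.
have te : t * (16 * M) <= e by rewrite -ler_pdivlMr ?mulr_gt0 // ge_min lexx orbT.
pose x1 := Num.max a (p - t); pose x2 := Num.min b (p + t).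
pose y1 := Num.max c (q - t); pose y2 := Num.min d (q + t).
(* Each side of the small rectangle either lies on the old border, so the strip beyond it is
   degenerate, or is strictly separated from the point, so [sub] kills the strip. *)
have x1p : [/\ a <= x1, x1 <= p, p - t <= x1 & (x1 = a \/ x1 < p)].
  by rewrite /x1; case: (leP a (p - t)) => h; split; try lra; (by left) || (right; lra).
have x2p : [/\ x2 <= b, p <= x2, x2 <= p + t & (x2 = b \/ p < x2)].
  by rewrite /x2; case: (leP b (p + t)) => h; split; try lra; (by left) || (right; lra).
have y1p : [/\ c <= y1, y1 <= q, q - t <= y1 & (y1 = c \/ y1 < q)].
  by rewrite /y1; case: (leP c (q - t)) => h; split; try lra; (by left) || (right; lra).
have y2p : [/\ y2 <= d, q <= y2, y2 <= q + t & (y2 = d \/ q < y2)].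
  by rewrite /y2; case: (leP d (q + t)) => h; split; try lra; (by left) || (right; lra).
case: x1p => ax1 x1p px1 cx1; case: x2p => bx2 x2p px2 cx2.
case: y1p => ay1 y1p py1 cy1; case: y2p => by2 y2p py2 cy2.
have -> : rect f a b c d = rect f x1 x2 y1 y2.
  rewrite (rect_splitx _ a b c d x1) (rect_splitx _ x1 b c d x2).
  have -> : rect f a x1 c d = 0.
    case: cx1 => [->|lt1]; first exact: rect0x.
    by apply: sub; rewrite ?lexx ?lt1 ?orbT //; lra.
  have -> : rect f x2 b c d = 0.
    case: cx2 => [->|lt1]; first exact: rect0x.
    by apply: sub; rewrite ?lexx ?lt1 ?orbT //; lra.
  rewrite (rect_splity _ x1 x2 c d y1) (rect_splity _ x1 x2 y1 d y2).
  have -> : rect f x1 x2 c y1 = 0.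
    case: cy1 => [->|lt1]; first exact: rect0y.
    by apply: sub; rewrite ?lexx ?lt1 ?orbT //; lra.
  have -> : rect f x1 x2 y2 d = 0.
    case: cy2 => [->|lt1]; first exact: rect0y.
    by apply: sub; rewrite ?lexx ?lt1 ?orbT //; lra.
  by ring.
apply: (@le_trans _ _ (4 * M * ((x2 - x1) + (y2 - y1)))).
  apply: rect_bound; [by []|lra|lra|] => x y /andP[hx1 hx2] /andP[hy1 hy2].
  pose h : R[i] := (x - p) +i* (y - q).
  have -> : x +i* y = p +i* q + h by apply: complex_ext => /=; ring.
  have hh : modC h < dl.
    apply: (@le_lt_trans _ _ (dl / 4 + dl / 4)); last lra.
    rewrite (le_trans (modC_le_ReIm _)) //= lerD //.
      by rewrite ler_norml; apply/andP; split; lra.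
    by rewrite ler_norml; apply/andP; split; lra.
  rewrite -[f (_ + _)](subrK (f (p +i* q))) (le_trans (modCD _ _)) //.
  by rewrite addrC /M lerD2l ltW // hdl.
apply: le_trans te; have -> : t * (16 * M) = 4 * M * (4 * t) by ring.
by rewrite ler_pM2l ?mulr_gt0 //; lra.
Qed.

End Rectangle.

(** * Primitives on a disk *)

Section BallPrimitive.
Variable R : realType.
Implicit Types f g : R[i] -> R[i].

(** The primitive integrates [f] from 0 along the real axis and then vertically. Goursat's theorem
    replaces the path to [z + h] by one through [z], so the increment only sees values of [f] close
    to [z]. *)
Lemma ex_primitive_ball f (z0 : R[i]) (r : R) : (forall z, ccont f z) ->
  (forall z : R[i], modC z < r -> z != z0 -> cdiff f z) ->
  exists F : R[i] -> R[i], forall z : R[i], modC z < r ->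
    cder F z (f z).
Proof.
move=> cf df.
pose F (z : R[i]) : R[i] := hor f 0 0 (complex.Re z) + 'i * ver f (complex.Re z) 0 (complex.Im z).
exists F => z zr e e0.
(* The increment has two legs, each estimated with the factor 2 of [cint_bound]. *)
have e40 : 0 < e / 4 by lra.
have /(_ _ e40) [dl dl0 hdl] := cf z.
exists (Num.min (dl / 2) (r - modC z)).
  by rewrite lt_min divr_gt0 //= subr_gt0.
move=> h; rewrite lt_min => /andP[hd hr].
set x := complex.Re z; set y := complex.Im z.
pose x' := complex.Re (z + h); pose y' := complex.Im (z + h).
have x'E : x' = x + complex.Re h by rewrite /x' ReD.
have y'E : y' = y + complex.Im h by rewrite /y' ImD.
have Reh := Re_le_modC h; have Imh := Im_le_modC h.
have r0 : rect f x x' 0 y = 0.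
  (* The rectangle stays in the ball: [x +i* v] has modulus at most [modC z], and the horizontal
     shift is at most [modC h], which is less than [r - modC z]. *)
  have sq u v : (Num.min x x' <= u <= Num.max x x') ->
      (Num.min 0 y <= v <= Num.max 0 y) -> u +i* v != z0 ->
      cdiff f (u +i* v).
    move=> hu hv; apply: df.
    have hu' : `|u - x| <= `|complex.Re h|.
      move: hu; rewrite x'E; case: (leP x) => hx /andP[hu1 hu2].
        have h0 : 0 <= complex.Re h by lra.
        by rewrite (ger0_norm h0) ger0_norm; lra.
      have h0 : complex.Re h <= 0 by lra.
      by rewrite (ler0_norm h0) ler0_norm; lra.
    have hv' : `|v| <= `|y|.
      move: hv; case: (leP 0) => hy /andP[hv1 hv2].
        by rewrite !ger0_norm //; lra.
      by rewrite !ler0_norm //; lra.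
    have -> : u +i* v = (x +i* v) + (u - x)%:C by apply: complex_ext => /=; ring.
    rewrite (le_lt_trans (modCD _ _)) // modC_real.
    have : modC (x +i* v) <= modC z.
      rewrite -ler_sqr ?nnegrE ?modC_ge0 // !modC_sqr /= lerD2l.
      rewrite -(real_normK (num_real v)) -(real_normK (num_real (complex.Im z))).
      by rewrite ler_sqr ?nnegrE.
    by lra.
  have main a b c d : a <= b -> c <= d ->
     (forall u v, a <= u <= b -> c <= v <= d -> u +i* v != z0 ->
      cdiff f (u +i* v)) -> rect f a b c d = 0.
    by move=> h1 h2 h3; apply: (goursat_except (z0 := z0)).
  case: (leP x x') sq => hx; case: (leP 0 y) => hy sq.
  - exact: main.
  - by rewrite rectNy main ?oppr0 // ltW.
  - by rewrite rectNx main ?oppr0 // ltW.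
  - by rewrite rectNx rectNy main ?oppr0 // ltW.
have FE : F (z + h) - F z = hor f y x x' + 'i * ver f x' y y'.
  move: r0; rewrite /F -/x -/y -/x' -/y' /rect /hor /ver /cint => E.
  apply/eqP; rewrite -subr_eq0; apply/eqP; rewrite -[RHS]E; ring.
(* The constant [f z] contributes exactly [f z * h] along the two legs, so the error is the integral
   of [g], which is small near [z]. *)
pose g := (fun w => f w - f z).
have cg w : ccont g w by apply: ccontB => //; exact: ccont_cst.
have cc w : ccont (fun _ => f z) w by exact: ccont_cst.
have dc w : cder (fun w => f z * w) w (f z) by exact: cder_linear.
have hc : hor f y x x' - hor g y x x' = f z * (x' - x)%:C.
  have -> : hor g y x x' = hor f y x x' - hor (fun=> f z) y x x'.
    by rewrite /hor -cintB //; [exact: continuous_hor|exact: (continuous_hor y cc)].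
  rewrite (hor_primitive y x x' cc dc) opprB addrC subrK -mulrBr; congr (_ * _).
  by apply: complex_ext => /=; ring.
have vc : 'i * ver f x' y y' - 'i * ver g x' y y' = f z * ('i * (y' - y)%:C).
  have -> : ver g x' y y' = ver f x' y y' - ver (fun=> f z) x' y y'.
    by rewrite /ver -cintB //; [exact: continuous_ver|exact: (continuous_ver x' cc)].
  rewrite (mulrBr 'i (ver f x' y y') (ver (fun=> f z) x' y y')) (ver_primitive x' y y' cc dc) opprB addrC subrK -mulrBr; congr (_ * _).
  by apply: complex_ext => /=; ring.
have -> : F (z + h) - F z - f z * h = hor g y x x' + 'i * ver g x' y y'.
  have hE : h = (x' - x)%:C + 'i * (y' - y)%:C.
    by rewrite x'E y'E; apply: complex_ext => /=; ring.
  have -> : f z * h = f z * (x' - x)%:C + f z * ('i * (y' - y)%:C).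
    by rewrite [in LHS]hE mulrDr.
  by rewrite FE -hc -vc; ring.
have near u v : `|u - x| <= `|complex.Re h| -> `|v - y| <= `|complex.Im h| ->
    modC (g (u +i* v)) <= e / 4.
  move=> h1 h2; rewrite /g.
  have -> : u +i* v = z + ((u - x) +i* (v - y)).
    by apply: complex_ext; rewrite /x /y /= ?ReD ?ImD /=; ring.
  apply/ltW/hdl; rewrite (le_lt_trans (modC_le_ReIm _)) //=; lra.
have btw (u p q : R) : Num.min p (p + q) <= u <= Num.max p (p + q) -> `|u - p| <= `|q|.
  case: (leP p) => hp /andP[hu1 hu2].
    have h0 : 0 <= q by lra.
    by rewrite (ger0_norm h0) ger0_norm; lra.
  have h0 : q <= 0 by lra.
  by rewrite (ler0_norm h0) ler0_norm; lra.
rewrite (le_trans (modCD _ _)) // modCM modCi mul1r.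
have B1 : modC (hor g y x x') <= 2 * (e / 4) * `|x' - x|.
  apply: cint_bound; first exact: continuous_hor.
  move=> u; rewrite x'E => /btw hu; apply: near => //.
  by rewrite subrr normr0.
have B2 : modC (ver g x' y y') <= 2 * (e / 4) * `|y' - y|.
  apply: cint_bound; first exact: continuous_ver.
  move=> u; rewrite y'E => /btw hu; apply: near => //.
  by rewrite x'E addrC addKr.
have x'x : x' - x = complex.Re h by rewrite x'E; ring.
have y'y : y' - y = complex.Im h by rewrite y'E; ring.
rewrite x'x in B1; rewrite y'y in B2.
have E1 : 2 * (e / 4) * `|complex.Re h| <= 2 * (e / 4) * modC h by rewrite ler_pM2l //; lra.
have E2 : 2 * (e / 4) * `|complex.Im h| <= 2 * (e / 4) * modC h by rewrite ler_pM2l //; lra.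
lra.
Qed.

End BallPrimitive.

(** * Rules of complex differentiation *)

Section CDerAlgebra.
Variable R : realType.
Implicit Types (f g : R[i] -> R[i]) (z l m : R[i]).
Local Notation C := (R[i])^o.

Lemma cder_eq f z l m : cder f z l -> l = m -> cder f z m.
Proof. by move=> H <-. Qed.

Lemma cder_near f g z l (d : R) : 0 < d ->
  (forall h : R[i], modC h < d -> f (z + h) = g (z + h)) -> cder f z l -> cder g z l.
Proof.
move=> d0 fg H e e0; have [d' d'0 hd'] := H e e0.
exists (Num.min d d'); first by rewrite lt_min d0.
move=> h; rewrite lt_min => /andP[hd /hd' {}hd'].
have E : g z = f z by have := fg 0; rewrite modC0 addr0 => /(_ d0).
by rewrite E -fg.
Qed.

Lemma cder_unique f z l m : cder f z l -> cder f z m -> l = m.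
Proof.
move=> /is_derive_cderP H1 /is_derive_cderP H2.
by rewrite -(@derive_val _ _ _ _ _ _ _ H1) (@derive_val _ _ _ _ _ _ _ H2).
Qed.

Lemma cder_cst k z : cder (fun=> k) z 0.
Proof.
move=> e e0; exists 1 => // h _; rewrite subrr mul0r subrr modC0.
by rewrite mulr_ge0 ?modC_ge0 // ltW.
Qed.

Lemma cder_id z : cder id z 1.
Proof.
move=> e e0; exists 1 => // h _; rewrite mul1r (addrC z) addrK subrr modC0.
by rewrite mulr_ge0 ?modC_ge0 // ltW.
Qed.

Lemma cderD f g z l m : cder f z l -> cder g z m ->
  cder (fun w => f w + g w) z (l + m).
Proof.
move=> H1 H2 e e0; have e2 : 0 < e / 2 by lra.
have [d1 d10 h1] := H1 _ e2; have [d2 d20 h2] := H2 _ e2.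
exists (Num.min d1 d2); first by rewrite lt_min d10.
move=> h; rewrite lt_min => /andP[/h1 {}h1 /h2 {}h2].
have -> : f (z + h) + g (z + h) - (f z + g z) - (l + m) * h =
  (f (z + h) - f z - l * h) + (g (z + h) - g z - m * h) by ring.
by rewrite (le_trans (modCD _ _)) //; lra.
Qed.

Lemma cder_comp f g z l m : cder f z l -> cder g (f z) m ->
  cder (fun w => g (f w)) z (m * l).
Proof.
move=> Hf Hg e e0.
pose K := modC l + 1; have K0 : 0 < K by rewrite ltr_wpDl ?modC_ge0.
pose L := modC m + 1; have L0 : 0 < L by rewrite ltr_wpDl ?modC_ge0.
have [d d0 hd] : exists2 d : R, 0 < d & forall h : R[i], modC h < d ->
    modC (g (f z + h) - g (f z) - m * h) <= e / 2 / K * modC h.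
  by apply: Hg; rewrite !divr_gt0.
have [d1 d10 h1] := Hf 1 ltr01.
have [d2 d20 h2] : exists2 d : R, 0 < d & forall s : R[i], modC s < d ->
    modC (f (z + s) - f z - l * s) <= e / 2 / L * modC s.
  by apply: Hf; rewrite !divr_gt0.
exists (Num.min (Num.min d1 d2) (d / K)).
  by rewrite !lt_min d10 d20 divr_gt0.
move=> s; rewrite !lt_min => /andP[/andP[/h1 {}h1 /h2 {}h2]].
rewrite ltr_pdivlMr // => sd.
set h := f (z + s) - f z in h1 h2 *.
have hK : modC h <= K * modC s.
  have -> : h = (h - l * s) + l * s by rewrite subrK.
  rewrite (le_trans (modCD _ _)) // modCM /K mulrDl addrC lerD //.
have hlt : modC h < d by rewrite (le_lt_trans hK) // mulrC.
have := hd h hlt; have -> : f z + h = f (z + s) by rewrite addrC subrK.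
move=> H1.
have -> : g (f (z + s)) - g (f z) - m * l * s =
  (g (f (z + s)) - g (f z) - m * h) + m * (h - l * s) by ring.
rewrite (le_trans (modCD _ _)) //.
have H2 : modC (g (f (z + s)) - g (f z) - m * h) <= e / 2 * modC s.
  rewrite (le_trans H1) // -mulrA ler_pM2l; last lra.
  by rewrite ler_pdivrMl.
have H3 : modC (m * (h - l * s)) <= e / 2 * modC s.
  rewrite modCM (@le_trans _ _ (L * (e / 2 / L * modC s))) //.
    by rewrite ler_pM ?modC_ge0 // /L lerDl.
  by rewrite mulrA mulrCA divff ?mulr1 ?gt_eqF.
lra.
Qed.

Lemma cderZ k f z l : cder f z l -> cder (fun w => k * f w) z (k * l).
Proof.
by move=> H; apply: (@cder_comp f (fun w => k * w)) => //; exact: cder_linear.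
Qed.

Lemma cderB f g z l m : cder f z l -> cder g z m ->
  cder (fun w => f w - g w) z (l - m).
Proof.
move=> H1 H2; have := cderD H1 (cderZ (-1) H2); rewrite mulN1r.
by apply: (@cder_near _ _ _ _ 1) => // h _; rewrite mulN1r.
Qed.

Lemma cder_sqr z : cder (fun w => w * w) z (2 * z).
Proof.
move=> e e0; exists e => // h he.
have -> : (z + h) * (z + h) - z * z - 2 * z * h = h * h by ring.
by rewrite modCM ler_wpM2r ?modC_ge0 // ltW.
Qed.

(** Polarization: [f g] is a quarter of [(f + g)^2 - (f - g)^2], so the chain rule with [cder_sqr]
    suffices. *)
Lemma cderM f g z l m : cder f z l -> cder g z m ->
  cder (fun w => f w * g w) z (l * g z + f z * m).
Proof.
move=> H1 H2.
have := cderZ (1 / 4) (cderB (cder_comp (cderD H1 H2) (cder_sqr _))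
                             (cder_comp (cderB H1 H2) (cder_sqr _))).
move=> /(@cder_near _ (fun w => f w * g w) _ _ 1 ltr01) H.
apply: cder_eq; first by apply: H => h _; field.
by rewrite /=; field.
Qed.

Lemma cder_inv z : z != 0 -> cder (fun w => w^-1) z (- (z ^+ 2)^-1).
Proof.
move=> z0 e e0; have m0 : 0 < modC z by rewrite modC_gt0.
(* The first bound keeps [z + h] at distance at least [modC z / 2] from 0; the second then absorbs
   the remainder [h^2 / (z^2 (z + h))]. *)
pose d := Num.min (modC z / 2) (e * modC z ^+ 3 / 2).
exists d; first by rewrite lt_min !divr_gt0 // mulr_gt0 // exprn_gt0.
move=> h; rewrite lt_min => /andP[h1 h2].
have zh : modC z / 2 <= modC (z + h).
  by have := modC_subl z (- h); rewrite opprK modCN; lra.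
have zh0 : z + h != 0 by rewrite -modC_gt0; lra.
have -> : (z + h)^-1 - z^-1 - - (z ^+ 2)^-1 * h = h * h / (z ^+ 2 * (z + h)).
  by field; rewrite z0 zh0.
rewrite !modCM modCV modCM modCX -mulrA mulrC ler_wpM2r ?modC_ge0 //.
rewrite ler_pdivrMr; last by rewrite mulr_gt0 ?exprn_gt0 ?modC_gt0.
rewrite (le_trans (ltW h2)) //.
have -> : e * modC z ^+ 3 / 2 = e * (modC z ^+ 2 * (modC z / 2)) by ring.
by rewrite ler_pM2l // ler_pM2l // exprn_gt0.
Qed.

Lemma cderV f z l : cder f z l -> f z != 0 ->
  cder (fun w => (f w)^-1) z (- l / f z ^+ 2).
Proof.
move=> H n0; apply: cder_eq; first exact: (cder_comp H (cder_inv n0)).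
by rewrite mulrC mulrN mulNr.
Qed.

Lemma cder_div f g z l m : cder f z l -> cder g z m -> g z != 0 ->
  cder (fun w => f w / g w) z ((l * g z - f z * m) / g z ^+ 2).
Proof.
move=> H1 H2 n0; apply: cder_eq; first exact: (cderM H1 (cderV H2 n0)).
by rewrite /=; field.
Qed.

Lemma cdiff_ccont f z : cdiff f z -> ccont f z.
Proof. by move=> [l /cder_continuous]. Qed.

Lemma cdiff_near f g z (d : R) : 0 < d ->
  (forall h : R[i], modC h < d -> f (z + h) = g (z + h)) -> cdiff f z -> cdiff g z.
Proof. by move=> d0 H [l hl]; exists l; exact: cder_near d0 H hl. Qed.

Lemma cdiff_div f g z : cdiff f z -> cdiff g z -> g z != 0 ->
  cdiff (fun w => f w / g w) z.
Proof. by move=> [l H1] [m H2] n0; eexists; exact: (cder_div H1 H2 n0). Qed.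

Lemma cdiff_cst k z : cdiff (fun=> k) z.
Proof. by exists 0; exact: cder_cst. Qed.

Lemma cdiff_id z : cdiff id z.
Proof. by exists 1; exact: cder_id. Qed.

Lemma cdiffB f g z : cdiff f z -> cdiff g z -> cdiff (fun w => f w - g w) z.
Proof. by move=> [l H1] [m H2]; exists (l - m); exact: cderB. Qed.

Lemma cdiffM f g z : cdiff f z -> cdiff g z -> cdiff (fun w => f w * g w) z.
Proof. by move=> [l H1] [m H2]; eexists; exact: cderM H1 H2. Qed.

Lemma cdiffX f z n : cdiff f z -> cdiff (fun w => f w ^+ n) z.
Proof.
move=> H; elim: n => [|n IH].
  by apply: (@cdiff_near (fun=> 1) _ z 1) => //; exact: cdiff_cst.
apply: (@cdiff_near (fun w => f w * f w ^+ n) _ z 1) => //.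
  by move=> h _; rewrite exprS.
exact: cdiffM.
Qed.

(** The real mean value theorem along the segment from 0 to [z], for each of the two components. *)
Lemma ball_cst f (r : R) : (forall w, modC w < r -> cder f w 0) ->
  forall z, modC z < r -> f z = f 0.
Proof.
move=> H z zr.
have dl (t : R) : 0 <= t <= 1 -> rder (fun s : R => f (z * s%:C)) t 0.
  move=> /andP[t0 t1]; rewrite -(mul0r z); apply: (@rder_comp R f (fun s : R => z * s%:C)).
    apply: H; rewrite modCM modC_real ger0_norm //; apply: le_lt_trans zr.
    by rewrite ler_piMr ?modC_ge0.
  exact: rder_line.
have MV (u : R -> R) : (forall t : R, 0 <= t <= 1 -> is_derive t 1 u 0) -> u 1 = u 0.
  move=> Hu; have [| |x _] := @MVT_segment R u (fun=> 0) 0 1 ler01.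
  - by move=> x; rewrite in_itv /= => /andP[x0 x1]; apply: Hu; rewrite !ltW.
  - apply: derivable_within_continuous => x; rewrite in_itv /= => hx.
    by have [] := Hu x hx.
  by rewrite mul0r => /eqP; rewrite subr_eq0 => /eqP.
apply: complex_ext.
  have := MV (fun s : R => complex.Re (f (z * s%:C))).
  rewrite mulr1 mulr0; apply => t /dl /rderP[+ _]; exact.
have := MV (fun s : R => complex.Im (f (z * s%:C))).
rewrite mulr1 mulr0; apply => t /dl /rderP[_]; exact.
Qed.

End CDerAlgebra.

(** * Extending functions from a disk to the plane *)

Section Retraction.
Variable R : realType.
Implicit Types (f : R[i] -> R[i]) (z : R[i]).

(** Radial projection onto the closed disk of radius [r]. Composing with it makes a function given
    on a larger disk continuous everywhere, as [cint] requires, without changing it on the disk. *)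
Definition retract (r : R) z : R[i] := z * r%:C / (Num.max r (modC z))%:C.

Lemma retract_id r z : 0 < r -> modC z <= r -> retract r z = z.
Proof.
move=> r0 zr; rewrite /retract max_l // mulfK //.
by rewrite -modC_gt0 modC_real gtr0_norm.
Qed.

Lemma modC_retract r z : 0 < r -> modC (retract r z) <= r.
Proof.
move=> r0; rewrite /retract !modCM modCV !modC_real.
have m0 : 0 < Num.max r (modC z) by rewrite lt_max r0.
rewrite !gtr0_norm // ler_pdivrMr // mulrC ler_pM2l //.
by rewrite le_max lexx orbT.
Qed.

Lemma ccont_retract r z : 0 < r -> ccont (retract r) z.
Proof.
move=> r0; apply: ccontM.
  by apply: ccontM; [exact: ccont_id|exact: ccont_cst].
apply: (@ccontV R (fun w => (Num.max r (modC w))%:C)); last first.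
  by rewrite -modC_gt0 modC_real gtr0_norm lt_max r0.
move=> e e0; exists e => // h he; apply: le_lt_trans he.
rewrite -rmorphB modC_real.
have h1 := modCD z h; have h2 := modC_subl z (- h); rewrite opprK modCN in h2.
rewrite ler_norml; apply/andP; split.
  by case: (leP r (modC (z + h))) => a; case: (leP r (modC z)) => b;
     have := modC_ge0 h; lra.
by case: (leP r (modC (z + h))) => a; case: (leP r (modC z)) => b;
     have := modC_ge0 h; lra.
Qed.

Lemma ball_primitive f z0 (r rho : R) : 0 < r -> r < rho ->
  (forall z, modC z < rho -> ccont f z) ->
  (forall z, modC z < rho -> z != z0 -> cdiff f z) ->
  exists F : R[i] -> R[i], forall z, modC z < r -> cder F z (f z).
Proof.
move=> r0 rr cf df.
have [||F HF] := @ex_primitive_ball R (fun z => f (retract r z)) z0 r.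
- move=> z; apply: ccont_comp; first exact: ccont_retract.
  by apply: cf; exact: le_lt_trans (modC_retract z r0) rr.
- move=> z zr zz0; apply: (@cdiff_near _ f _ _ (r - modC z)); last exact: df (lt_trans zr rr) zz0.
    by rewrite subr_gt0.
  move=> h hr; rewrite retract_id // (le_trans (modCD _ _)) //; lra.
by exists F => z zr; have := HF z zr; rewrite retract_id // ltW.
Qed.

End Retraction.

(** * Cauchy's formula *)

Section Circle.
Local Open Scope classical_set_scope.
Variable R : realType.
Implicit Types (f : R[i] -> R[i]) (z : R[i]) (phi : R -> R[i]).

Lemma modC_expi (a : R) : modC (expi a) = 1.
Proof. by rewrite /modC /= cos2Dsin2 sqrtr1. Qed.

Lemma rder_expi (t : R) : rder (@expi R) t ('i * expi t).
Proof.
apply/rderP; rewrite !ReImE /= !mul0r !mul1r sub0r add0r; split.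
  exact: is_derive_cos.
exact: is_derive_sin.
Qed.

Lemma expi0 : expi (0 : R) = 1.
Proof. by rewrite /expi cos0 sin0. Qed.

Lemma expi2pi : expi (pi *+ 2 : R) = 1.
Proof. by rewrite /expi cos2pi sin2pi. Qed.

Definition circ (r t : R) : R[i] := r%:C * expi t.

Lemma rder_circ (r t : R) : rder (circ r) t ('i * circ r t).
Proof. by rewrite /circ mulrCA; apply: rderZ; exact: rder_expi. Qed.

Lemma rcont_circ (r t : R) : rcont (circ r) t.
Proof. exact: rder_continuous (rder_circ r t). Qed.

Lemma modC_circ (r t : R) : 0 < r -> modC (circ r t) = r.
Proof. by move=> r0; rewrite modCM modC_expi modC_real gtr0_norm ?mulr1. Qed.

Lemma pi2_gt0 : 0 < pi *+ 2 :> R.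
Proof. by rewrite mulrn_wgt0 // pi_gt0. Qed.

Local Notation P2 := (pi *+ 2 : R).

Lemma rcont_bounded phi (a b : R) : a <= b -> (forall t, rcont phi t) ->
  exists2 M : R, 0 < M & forall t, a <= t <= b -> modC (phi t) <= M.
Proof.
move=> ab c.
have [||x _ Hx] := @EVT_max R (fun t => modC (phi t)) a b.
- exact: ab.
- apply: continuous_subspaceT => t; have /rcontP ct := c t.
  exact: (continuous_comp ct (@continuous_modC _ _)).
exists (modC (phi x) + 1); first by rewrite ltr_wpDl ?modC_ge0.
by move=> t tab; rewrite (le_trans (Hx t _)) ?lerDl.
Qed.

(** Differentiation under the integral sign needs no convergence theorem here: a second-order
    remainder uniform in [t] is integrated by [cint_bound]. *)
Lemma cder_cint (K : R -> R[i] -> R[i]) (K1 : R -> R[i]) z (d B : R) : 0 < d -> 0 < B ->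
  (forall h : R[i], modC h < d -> forall t, rcont (fun s => K s (z + h)) t) ->
  (forall t, rcont K1 t) ->
  (forall (h : R[i]) t, 0 <= t <= P2 -> modC h < d ->
    modC (K t (z + h) - K t z - K1 t * h) <= B * modC h ^+ 2) ->
  cder (fun w => cint 0 P2 (fun t => K t w)) z (cint 0 P2 K1).
Proof.
move=> d0 B0 cK cK1 H e e0.
pose A := 2 * B * P2.
have A0 : 0 < A by rewrite !mulr_gt0 // pi2_gt0.
exists (Num.min d (e / A)); first by rewrite lt_min d0 divr_gt0.
move=> h; rewrite lt_min => /andP[hd]; rewrite ltr_pdivlMr // => hA.
have cK0 : forall t, rcont (fun s => K s z) t.
  by move=> t; have := cK 0; rewrite modC0 addr0; apply.
have cK1h : forall t, rcont (fun s => h * K1 s) t.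
  by move=> t; apply: rcontM => //; exact: rcont_cst.
rewrite [cint 0 P2 K1 * h]mulrC -cintZ // -cintB //; last exact: cK.
rewrite -cintB //; last first.
  by move=> t; apply: rcontB => //; exact: cK.
apply: (@le_trans _ _ (2 * (B * modC h ^+ 2) * `|P2 - 0|)).
  apply: cint_bound.
    move=> t; apply: rcontB => //; apply: rcontB => //; exact: cK.
  move=> t; rewrite min_l ?max_r ?(ltW pi2_gt0) // => ht.
  by rewrite (mulrC h); exact: H.
rewrite subr0 gtr0_norm ?pi2_gt0 //.
have -> : 2 * (B * modC h ^+ 2) * P2 = A * modC h * modC h by rewrite /A; ring.
by rewrite ler_wpM2r ?modC_ge0 // mulrC ltW.
Qed.

Section Kernel.
Variables (r : R) (r0 : 0 < r) (phi : R -> R[i]) (cphi : forall t, rcont phi t).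

Lemma circ_sub_ge z t : r - modC z <= modC (circ r t - z).
Proof. by rewrite -{1}(modC_circ t r0); exact: modC_subl. Qed.

Lemma circ_sub_neq0 z t : modC z < r -> circ r t - z != 0.
Proof.
by move=> zr; rewrite -modC_gt0; apply: lt_le_trans (circ_sub_ge z t); rewrite subr_gt0.
Qed.

Lemma rcont_kernel z n : modC z < r -> forall t,
  rcont (fun s => phi s / (circ r s - z) ^+ n) t.
Proof.
move=> zr t; apply: rcontM => //.
apply: (@rcontV R (fun s => (circ r s - z) ^+ n)); last first.
  by rewrite expf_neq0 // circ_sub_neq0.
elim: n => [|n IH].
  by rewrite (_ : (fun s => _) = fun=> 1); [exact: rcont_cst|apply/funext => s].
rewrite (_ : (fun s => _) = fun s => (circ r s - z) * (circ r s - z) ^+ n).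
  by apply: rcontM => //; apply: rcontB; [exact: rcont_circ|exact: rcont_cst].
by apply/funext => s; rewrite exprS.
Qed.

Lemma modC_addh_lt z h : modC z < r -> modC h < (r - modC z) / 2 -> modC (z + h) < r.
Proof. by move=> zr hd; rewrite (le_lt_trans (modCD _ _)) //; lra. Qed.

(** With [u = circ r t - z], the remainder of [1/(u - h)] is [h^2 / (u^2 (u - h))]. Halving the
    distance [d] to the circle keeps [u - h] at least [d / 2] in modulus. The exponent 1 is kept to
    match [rcont_kernel]. *)
Lemma kernel1 z : modC z < r ->
  cder (fun w => cint 0 P2 (fun t => phi t / (circ r t - w) ^+ 1)) z
       (cint 0 P2 (fun t => phi t / (circ r t - z) ^+ 2)).
Proof.
move=> zr; pose d := r - modC z; have d0 : 0 < d by rewrite subr_gt0.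
have [M M0 HM] := rcont_bounded (ltW pi2_gt0) cphi.
apply: (@cder_cint _ _ _ (d / 2) (M * (2 / d ^+ 3))).
- by rewrite divr_gt0.
- by rewrite mulr_gt0 // divr_gt0 // exprn_gt0.
- by move=> h hd t; apply: rcont_kernel; exact: modC_addh_lt.
- by move=> t; exact: rcont_kernel.
move=> h t ht hd.
have ud := circ_sub_ge z t; have u0 := circ_sub_neq0 t zr.
have vd := circ_sub_ge (z + h) t.
have v0 := circ_sub_neq0 t (modC_addh_lt zr hd).
set u := circ r t - z in ud u0 *; rewrite opprD addrA -/u in vd v0 *.
have {}vd : d / 2 <= modC (u - h).
  by apply: le_trans vd; have := modCD z h; rewrite /d in hd *; lra.
have -> : phi t / (u - h) ^+ 1 - phi t / u ^+ 1 - phi t / u ^+ 2 * h =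
  phi t * (h ^+ 2 / (u ^+ 2 * (u - h))) by field; rewrite u0 v0.
rewrite modCM -mulrA ler_pM ?modC_ge0 ?HM // modCM modCV modCM !modCX mulrC.
rewrite ler_wpM2r ?exprn_ge0 ?modC_ge0 //.
have -> : 2 / d ^+ 3 = (d ^+ 2 * (d / 2))^-1 by field; rewrite gt_eqF.
rewrite lef_pV2 ?posrE ?mulr_gt0 ?exprn_gt0 ?divr_gt0 ?modC_gt0 //.
apply: ler_pM => //; rewrite ?exprn_ge0 ?divr_ge0 ?(ltW d0) //.
by rewrite lerXn2r ?nnegrE ?(ltW d0) ?modC_ge0.
Qed.

Lemma kernel2 z : modC z < r ->
  cdiff (fun w => cint 0 P2 (fun t => phi t / (circ r t - w) ^+ 2)) z.
Proof.
move=> zr; pose d := r - modC z; have d0 : 0 < d by rewrite subr_gt0.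
have [M M0 HM] := rcont_bounded (ltW pi2_gt0) cphi.
exists (cint 0 P2 (fun t => 2 * (phi t / (circ r t - z) ^+ 3))).
(* [L] bounds the factor [3 u - 2 h] of the remainder: its modulus is at most
   [3 (r + |z|) + 2 |h| < 7 r]. *)
have [L L0 LE] : exists2 L : R, 0 < L & 7 * r < L.
  by exists (8 * r); [rewrite mulr_gt0|rewrite ltr_pM2r // ltr_nat].
apply: (@cder_cint _ _ _ (d / 2) (M * (L * (d ^+ 3 * (d / 2) ^+ 2)^-1))).
- by rewrite divr_gt0.
- by rewrite !mulr_gt0 // invr_gt0 mulr_gt0 // exprn_gt0 // divr_gt0.
- by move=> h hd t; apply: rcont_kernel; exact: modC_addh_lt.
- by move=> t; apply: rcontM; [exact: rcont_cst|exact: rcont_kernel].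
move=> h t ht hd.
have ud := circ_sub_ge z t; have u0 := circ_sub_neq0 t zr.
have vd := circ_sub_ge (z + h) t.
have v0 := circ_sub_neq0 t (modC_addh_lt zr hd).
have uL : modC (3 * (circ r t - z) - 2 * h) <= L.
  have := modCB (3 * (circ r t - z)) (2 * h); have := modCB (circ r t) z.
  rewrite (modC_circ t r0) (modCM 3) (modCM 2) (modC_nat R 2) (modC_nat R 3).
  have := modC_ge0 z; rewrite /d in hd *; lra.
set u := circ r t - z in ud u0 uL *; rewrite opprD addrA -/u in vd v0 *.
have {}vd : d / 2 <= modC (u - h).
  by apply: le_trans vd; have := modCD z h; rewrite /d in hd *; lra.
have -> : phi t / (u - h) ^+ 2 - phi t / u ^+ 2 - 2 * (phi t / u ^+ 3) * h =
  phi t * ((3 * u - 2 * h) * (u ^+ 3 * (u - h) ^+ 2)^-1 * h ^+ 2).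
  by field; rewrite u0 v0.
rewrite modCM -(mulrA M) ler_pM ?modC_ge0 ?HM //.
rewrite (modCM _ (h ^+ 2)) (modCX h 2) ler_wpM2r ?exprn_ge0 ?modC_ge0 //.
rewrite modCM; apply: ler_pM; rewrite ?modC_ge0 //.
rewrite modCV modCM !modCX.
rewrite lef_pV2 ?posrE ?mulr_gt0 ?exprn_gt0 ?divr_gt0 ?modC_gt0 //.
apply: ler_pM; rewrite ?exprn_ge0 ?divr_ge0 ?(ltW d0) //.
  by rewrite lerXn2r ?nnegrE ?(ltW d0) ?modC_ge0.
by rewrite lerXn2r ?nnegrE ?divr_ge0 ?(ltW d0) ?modC_ge0.
Qed.

End Kernel.

Lemma cint_cst (k : R[i]) (a b : R) : cint a b (fun=> k) = k * (b - a)%:C.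
Proof.
rewrite (@cint_FTC _ _ (fun t => k * t%:C)).
- by rewrite -mulrBr -rmorphB.
- by move=> t; exact: rcont_cst.
by move=> t; exact: rder_line.
Qed.

Lemma eq_cint (phi psi : R -> R[i]) (a b : R) : phi =1 psi -> cint a b phi = cint a b psi.
Proof. by move=> /funext ->. Qed.

(* The kernel integral has derivative [int zeta/(zeta - z)^2 dt = 0], the
   integrand being the derivative in t of [i/(zeta - z)]. *)
Lemma winding_number (r : R) z : 0 < r -> modC z < r ->
  cint 0 P2 (fun t => circ r t / (circ r t - z)) = P2%:C.
Proof.
move=> r0 zr.
pose J w := cint 0 P2 (fun t => circ r t / (circ r t - w) ^+ 1).
have -> : cint 0 P2 (fun t => circ r t / (circ r t - z)) = J z.
  by apply: eq_cint => t; rewrite expr1.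
have dJ w : modC w < r -> cder J w 0.
  move=> wr; apply: cder_eq; first exact: (kernel1 r0 (rcont_circ r) wr).
  rewrite (@cint_FTC _ _ (fun t => 'i * (circ r t - w)^-1)).
  - by rewrite /circ expi0 expi2pi subrr.
  - by move=> t; apply: (@rcont_kernel r r0 (circ r)) => // s; exact: rcont_circ.
  move=> t.
  have n0 := circ_sub_neq0 r0 t wr.
  have H := @rder_comp R (fun u => 'i * (u - w)^-1) (circ r) t.
  have D : cder (fun u => 'i * (u - w)^-1) (circ r t)
     ('i * (- (1 - 0) / (circ r t - w) ^+ 2)).
    apply: cderZ; apply: (cderV (f := fun u => u - w)) n0.
    by apply: cderB; [exact: cder_id|exact: cder_cst].
  have := H _ _ D (rder_circ r t).
  have -> : 'i * (- (1 - 0) / (circ r t - w) ^+ 2) * ('i * circ r t) =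
     - ('i ^+ 2) * (circ r t / (circ r t - w) ^+ 2) by field.
  by rewrite sqr_i opprK mul1r.
rewrite (ball_cst dJ zr) /J -[RHS]mul1r -[X in X%:C]subr0 -cint_cst.
apply: eq_cint => t; rewrite subr0 expr1 divff //.
by rewrite -modC_gt0 modC_circ.
Qed.

(** The difference quotient, completed by the derivative at [z], is continuous there and
    differentiable elsewhere: exactly what Goursat's theorem with an exceptional point accepts. *)
Lemma ex_slope f (rho : R) z : (forall w, modC w < rho -> cdiff f w) -> modC z < rho ->
  exists q : R[i] -> R[i],
  [/\ forall w, f w - f z = (w - z) * q w, cder f z (q z),
      forall w, modC w < rho -> ccont q w &
      forall w, modC w < rho -> w != z -> cdiff q w].
Proof.
move=> df zr; have [l dl] := df z zr.
pose q w := if w == z then l else (f w - f z) / (w - z).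
have qE w : w != z -> exists2 d : R, 0 < d & forall h, modC h < d ->
    (f (w + h) - f z) / (w + h - z) = q (w + h).
  move=> wz; exists (modC (w - z)); first by rewrite modC_gt0 subr_eq0.
  move=> h hd; rewrite /q ifF //; apply/negbTE/eqP => E.
  by move: hd; rewrite -E opprD addrA subrr sub0r modCN ltxx.
have dq w : modC w < rho -> w != z -> cdiff q w.
  move=> wr wz; have [d d0 hd] := qE w wz.
  apply: (@cdiff_near R (fun u => (f u - f z) / (u - z)) q w d d0 hd).
  apply: (@cdiff_div R (fun u => f u - f z) (fun u => u - z)).
  - by apply: cdiffB; [exact: df|exact: cdiff_cst].
  - by apply: cdiffB; [exact: cdiff_id|exact: cdiff_cst].
  - by rewrite subr_eq0.
have cq w : modC w < rho -> ccont q w.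
  move=> wr; have [->|wz] := eqVneq w z; last exact/cdiff_ccont/dq.
  move=> e e0; have e2 : 0 < e / 2 by lra.
  have [d d0 hd] := dl _ e2; exists d => // h /hd {}hd.
  rewrite {2}/q eqxx /q; case: eqP => [_|]; first by rewrite subrr modC0.
  move=> /eqP; rewrite addrC -subr_eq0 addrK => h0.
  have -> : (f (h + z) - f z) / h - l = (f (h + z) - f z - l * h) / h.
    by field.
  rewrite modCM modCV ltr_pdivrMr ?modC_gt0 //; rewrite (addrC z h) in hd.
  apply: le_lt_trans hd _; rewrite ltr_pM2r ?modC_gt0 //; lra.
exists q; split => //; last by rewrite /q eqxx.
move=> w; rewrite /q; case: eqP => [->|/eqP wz]; first by rewrite !subrr mul0r.
by rewrite mulrCA divff ?mulr1 // subr_eq0.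
Qed.

(** In the parametrization [zeta = circ r t] one has [dzeta = i zeta dt]: hence the factor
    [circ r t], and [2 pi] in place of [2 pi i]. *)
Lemma cauchy_formula f (r rho : R) z : 0 < r -> r < rho ->
  (forall w, modC w < rho -> cdiff f w) -> modC z < r ->
  P2%:C * f z = cint 0 P2 (fun t => f (circ r t) * circ r t / (circ r t - z)).
Proof.
move=> r0 rr df zr.
(* [ball_primitive] loses some radius, and the circle of radius [r] must lie strictly inside the
   disk where the primitive lives. *)
pose r' := (r + rho) / 2; have r'1 : r < r' by rewrite /r'; lra.
have r'2 : r' < rho by rewrite /r'; lra.
have [q [fq _ cq dq]] := ex_slope df (lt_trans zr rr).
have [Q HQ] := ball_primitive (lt_trans r0 r'1) r'2 cq dq.
have cf t : rcont (fun s => f (circ r s)) t.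
  apply: rcont_comp; first exact: rcont_circ.
  by apply/cdiff_ccont/df; rewrite modC_circ.
have c1 t : rcont (fun s => f (circ r s) * circ r s / (circ r s - z)) t.
  apply: rcontM; first by apply: rcontM => //; exact: rcont_circ.
  apply: (@rcontV R (fun s => circ r s - z)).
    by apply: rcontB; [exact: rcont_circ|exact: rcont_cst].
  exact: circ_sub_neq0.
have c2 t : rcont (fun s => circ r s / (circ r s - z)) t.
  apply: rcontM; first exact: rcont_circ.
  apply: (@rcontV R (fun s => circ r s - z)).
    by apply: rcontB; [exact: rcont_circ|exact: rcont_cst].
  exact: circ_sub_neq0.
have c3 t : rcont (fun s => f z * (circ r s / (circ r s - z))) t.
  by apply: rcontM => //; exact: rcont_cst.
have c4 t : rcont (fun s => f (circ r s) * circ r s / (circ r s - z) -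
                  f z * (circ r s / (circ r s - z))) t by exact: rcontB.
have : cint 0 P2 (fun t => 'i * (f (circ r t) * circ r t / (circ r t - z) -
    f z * (circ r t / (circ r t - z)))) = 0.
  rewrite (@cint_FTC _ _ (fun t => Q (circ r t))).
  - by rewrite /circ expi0 expi2pi subrr.
  - by move=> t; apply: rcontM => //; exact: rcont_cst.
  move=> t; have n0 := circ_sub_neq0 r0 t zr.
  have := rder_comp (HQ (circ r t) _) (rder_circ r t).
  rewrite modC_circ // => /(_ r'1).
  have -> // : q (circ r t) * ('i * circ r t) =
    'i * (f (circ r t) * circ r t / (circ r t - z) -
     f z * (circ r t / (circ r t - z))).
  have -> : q (circ r t) = (f (circ r t) - f z) / (circ r t - z).
    by rewrite fq mulrC mulKf.
  by field.
rewrite cintZ // => /eqP; rewrite mulf_eq0 => /orP[|].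
  by rewrite -modC_eq0 modCi oner_eq0.
rewrite cintB // subr_eq0 => /eqP ->.
by rewrite cintZ // winding_number // mulrC.
Qed.

End Circle.

(** * Consequences of Cauchy's formula *)

Section Holomorphic.
Local Open Scope classical_set_scope.
Variable R : realType.
Implicit Types (f q : R[i] -> R[i]) (z : R[i]).
Local Notation P2 := (pi *+ 2 : R).

(** Cauchy's formula expresses [f] by the kernel of exponent 1. [kernel1] identifies [f1] with the
    integral of exponent 2, and [kernel2] differentiates that once more. *)
Lemma cdiff_deriv f f1 (rho : R) : (forall w, modC w < rho -> cder f w (f1 w)) ->
  forall z, modC z < rho -> cdiff f1 z.
Proof.
move=> df z zr; pose r := (modC z + rho) / 2.
have z0 := modC_ge0 z.
have r0 : 0 < r by rewrite /r; lra.
have zr' : modC z < r by rewrite /r; lra.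
have rr : r < rho by rewrite /r; lra.
have df' w : modC w < rho -> cdiff f w by exists (f1 w); exact: df.
pose phi t := f (circ r t) * circ r t.
have cphi t : rcont phi t.
  apply: rcontM; last exact: rcont_circ.
  apply: rcont_comp; first exact: rcont_circ.
  by apply/cdiff_ccont/df'; rewrite modC_circ.
have P0 : P2%:C != 0 by rewrite -modC_gt0 modC_real gtr0_norm pi2_gt0.
pose G w := P2%:C^-1 * cint 0 P2 (fun t => phi t / (circ r t - w) ^+ 1).
pose G1 w := P2%:C^-1 * cint 0 P2 (fun t => phi t / (circ r t - w) ^+ 2).
have fG w : modC w < r -> f w = G w.
  move=> wr; apply: (mulfI P0); rewrite (cauchy_formula r0 rr df' wr) /G mulrA divff //.
  by rewrite mul1r; apply: eq_cint => t; rewrite expr1.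
have f1G w : modC w < r -> f1 w = G1 w.
  move=> wr; apply: (@cder_unique R f w); first exact: df (lt_trans wr rr).
  apply: (@cder_near R G f w _ (r - modC w)); first by rewrite subr_gt0.
    move=> h hr; rewrite fG // (le_lt_trans (modCD _ _)) //; lra.
  by apply: cderZ; exact: kernel1.
apply: (@cdiff_near R G1 f1 z (r - modC z)); first by rewrite subr_gt0.
  move=> h hr; rewrite f1G // (le_lt_trans (modCD _ _)) //; lra.
by apply: cdiffM; [exact: cdiff_cst|exact: kernel2].
Qed.

(** [q] is the derivative of its own primitive, and derivatives are differentiable. *)
Lemma removable_singularity q z0 (rho : R) :
  (forall w, modC w < rho -> ccont q w) ->
  (forall w, modC w < rho -> w != z0 -> cdiff q w) ->
  forall z, modC z < rho -> cdiff q z.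
Proof.
move=> cq dq z zr; pose r := (modC z + rho) / 2.
have z00 := modC_ge0 z.
have r0 : 0 < r by rewrite /r; lra.
have rr : r < rho by rewrite /r; lra.
have [Q HQ] := ball_primitive r0 rr cq dq.
by apply: (cdiff_deriv HQ); rewrite /r; lra.
Qed.

Lemma ex_quotient f (rho : R) : 0 < rho -> (forall w, modC w < rho -> cdiff f w) ->
  f 0 = 0 -> exists q, [/\ forall w, f w = w * q w, cder f 0 (q 0) &
    forall w, modC w < rho -> cdiff q w].
Proof.
move=> rho0 df f0; have z0 : modC (0 : R[i]) < rho by rewrite modC0.
have [q [fq dq cq dq']] := ex_slope df z0.
exists q; split => //.
  by move=> w; have := fq w; rewrite f0 !subr0.
exact: removable_singularity cq dq'.
Qed.

(** Bernoulli's inequality makes the powers of [a] unbounded as soon as [a] exceeds 1. *)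
Lemma expr_bounded_le1 (a K : R) : 0 <= a -> (forall n, a ^+ n <= K) -> a <= 1.
Proof.
move=> a0 H; rewrite leNgt; apply/negP => a1.
have B n : 1 + n%:R * (a - 1) <= a ^+ n.
  elim: n => [|n IH]; first by rewrite mul0r addr0 expr0.
  rewrite exprS -natr1; apply: (@le_trans _ _ (a * (1 + n%:R * (a - 1)))); last first.
    by rewrite ler_wpM2l.
  have : 0 <= n%:R * (a - 1) ^+ 2 by rewrite mulr_ge0 ?sqr_ge0.
  by nra.
have x0 : 0 < a - 1 by rewrite subr_gt0.
have h : `|K| / (a - 1) < (Num.bound (`|K| / (a - 1)))%:R.
  by apply: archi_boundP; rewrite divr_ge0 // ltW.
rewrite ltr_pdivrMr // in h.
have := le_trans (B _) (H (Num.bound (`|K| / (a - 1)))).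
have := ler_norm K; lra.
Qed.

(* Landau's trick: Cauchy's formula for [f^n] loses a constant independent of
   [n], which disappears on taking [n]-th roots. *)
Lemma maximum_principle f (r rho M : R) z : 0 < r -> r < rho -> 0 < M ->
  (forall w, modC w < rho -> cdiff f w) ->
  (forall t, modC (f (circ r t)) <= M) -> modC z < r -> modC (f z) <= M.
Proof.
move=> r0 rr M0 df fM zr.
have d0 : 0 < r - modC z by rewrite subr_gt0.
have P0 := pi2_gt0 R.
(* The factor 2 of [cint_bound] times the largest value of [|zeta| / |zeta - z|] on the circle; it
   does not depend on [n]. *)
pose K := 2 * (r / (r - modC z)).
suff : modC (f z) / M <= 1 by rewrite ler_pdivrMr // mul1r.
apply: (@expr_bounded_le1 _ K); first by rewrite divr_ge0 ?modC_ge0 // ltW.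
move=> n; rewrite expr_div_n ler_pdivrMr ?exprn_gt0 //.
have dfn w : modC w < rho -> cdiff (fun u => f u ^+ n) w.
  by move=> /df; exact: cdiffX.
have := cauchy_formula r0 rr dfn zr.
move=> /(congr1 (@modC R)); rewrite modCM modC_real gtr0_norm // modCX => E.
rewrite -(ler_pM2l P0) E.
apply: (@le_trans _ _ (2 * (M ^+ n * (r / (r - modC z))) * `|P2 - 0|)); last first.
  by rewrite subr0 gtr0_norm // /K le_eqVlt; apply/orP; left; apply/eqP; ring.
apply: cint_bound.
  move=> t; apply: rcontM.
    apply: rcontM; last exact: rcont_circ.
    apply: (@rcont_comp R (fun u => f u ^+ n)); first exact: rcont_circ.
    by apply/cdiff_ccont/dfn; rewrite modC_circ.
  apply: (@rcontV R (fun s => circ r s - z)).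
    by apply: rcontB; [exact: rcont_circ|exact: rcont_cst].
  exact: circ_sub_neq0.
move=> t _; rewrite modCM modCM modCV modCX modC_circ // -mulrA.
apply: ler_pM; rewrite ?exprn_ge0 ?modC_ge0 ?divr_ge0 ?(ltW r0) ?modC_ge0 //.
  by rewrite lerXn2r ?nnegrE ?modC_ge0 ?(ltW M0).
rewrite ler_pM2l // lef_pV2 ?posrE //; first exact: circ_sub_ge.
by rewrite modC_gt0 circ_sub_neq0.
Qed.

(** The maximum principle for [f(w)/w], which is at most [1 / r] in modulus on the circle. *)
Lemma schwarz f (r rho : R) z : 0 < r -> r < rho ->
  (forall w, modC w < rho -> cdiff f w) -> f 0 = 0 ->
  (forall w, modC w = r -> modC (f w) <= 1) -> modC z < r ->
  modC (f z) <= modC z / r.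
Proof.
move=> r0 rr df f0 f1 zr.
have [q [fq _ dq]] := ex_quotient (lt_trans r0 rr) df f0.
rewrite fq modCM ler_wpM2l ?modC_ge0 //.
apply: (maximum_principle r0 rr _ dq _ zr); first by rewrite invr_gt0.
move=> t; rewrite -[r^-1]mul1r ler_pdivlMr // -[X in _ * X <= _](modC_circ t r0).
by rewrite mulrC -modCM -fq f1 // modC_circ.
Qed.

(** Primitives on smaller disks, normalized at 0, agree where they overlap and are glued by letting
    the radius depend on the point. *)
Lemma ex_primitive_disk f : (forall w, modC w < 1 -> cdiff f w) ->
  exists F : R[i] -> R[i], F 0 = 0 /\ forall w, modC w < 1 -> cder F w (f w).
Proof.
move=> df.
have /choice[G HG] : forall r : R, exists F : R[i] -> R[i], 0 < r < 1 ->
    F 0 = 0 /\ forall w, modC w < r -> cder F w (f w).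
  move=> r; have [/andP[r0 r1]|_] := boolP (0 < r < 1); last by exists id.
  have cf w : modC w < 1 -> ccont f w by move=> /df/cdiff_ccont.
  have df' w : modC w < 1 -> w != 0 -> cdiff f w by move=> /df.
  have [F HF] := ball_primitive r0 r1 cf df'.
  exists (fun w => F w - F 0) => _; split; first by rewrite subrr.
  move=> w wr; rewrite -[f w]subr0; apply: cderB; first exact: HF.
  exact: cder_cst.
have agree (r s : R) w : 0 < r < 1 -> 0 < s < 1 -> modC w < r -> modC w < s -> G r w = G s w.
  move=> /HG[Gr0 Gr] /HG[Gs0 Gs] wr ws.
  have E : G r w - G s w = G r 0 - G s 0.
    apply: (@ball_cst R (fun w => G r w - G s w) (Num.min r s)).
      move=> u; rewrite lt_min => /andP[ur us]; rewrite -(subrr (f u)).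
      by apply: cderB; [exact: Gr|exact: Gs].
    by rewrite lt_min wr.
  by apply/eqP; rewrite -subr_eq0 E Gr0 Gs0 subrr.
(* A radius strictly between [modC w] and 1; near [w] the fixed radius [rad w] gives the same values
   by [agree]. *)
pose rad w : R := (1 + modC w) / 2.
have rad1 w : modC w < 1 -> 0 < rad w < 1 /\ modC w < rad w.
  by move=> w1; have := modC_ge0 w; split; rewrite /rad; [apply/andP; split|]; lra.
exists (fun w => G (rad w) w); split.
  have [|h _] := rad1 0; first by rewrite modC0.
  by have [] := HG _ h.
move=> w w1; have [h1 h2] := rad1 w w1.
apply: (@cder_near R (G (rad w)) _ w _ (rad w - modC w)); first by rewrite subr_gt0.
  move=> h hr; have wh : modC (w + h) < rad w.
    by rewrite (le_lt_trans (modCD _ _)) //; lra.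
  have [|h3 h4] := rad1 (w + h); last exact: agree.
  by case/andP: h1 => _; exact: lt_trans.
by have [_] := HG _ h1; apply.
Qed.

Definition ucont (u : R[i] -> R) z := forall e : R, 0 < e ->
  exists2 d : R, 0 < d & forall h, modC h < d -> `|u (z + h) - u z| < e.

(** [z0] realizes the least modulus [rs] among points where [u <= 0]. That it is attained is a
    compactness statement, obtained from [quadrisection] on a square containing the disk. *)
Lemma first_zero (u : R[i] -> R) : (forall z, modC z < 1 -> ucont u z) -> 0 < u 0 ->
  (exists2 z, modC z < 1 & u z <= 0) ->
  exists z0, [/\ 0 < modC z0, modC z0 < 1, u z0 = 0 &
     forall z, modC z <= modC z0 -> 0 <= u z].
Proof.
move=> cu u0 [zb zb1 uzb].
pose S := [set x : R | exists z, [/\ x = modC z, modC z < 1 & u z <= 0]].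
have Sb : has_lbound S by exists 0 => _ [z [-> _ _]]; exact: modC_ge0.
have S0 : S !=set0 by exists (modC zb), zb.
pose rs := inf S.
have rsle z : modC z < 1 -> u z <= 0 -> rs <= modC z.
  by move=> z1 uz; apply: (ge_inf Sb); exists z.
have rs1 : rs < 1 := le_lt_trans (rsle _ zb1 uzb) zb1.
have upos z : modC z < rs -> 0 < u z.
  move=> zr; rewrite ltNge; apply/negP => uz.
  have := rsle z (lt_trans zr rs1) uz.
  by rewrite leNgt zr.
have [z0 z0r uz0] : exists2 z0, modC z0 <= rs & u z0 <= 0.
  apply: contrapT => N.
  have N' z : modC z <= rs -> 0 < u z.
    by move=> zr; rewrite ltNge; apply/negP => uz; apply: N; exists z.
  (* If [u > 0] on the closed disk of radius [rs], positivity extends to radius [rs + e],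
     contradicting the choice of [rs] as an infimum. *)
  pose P (a b c d : R) := exists2 e : R, 0 < e & forall x y : R,
    a <= x <= b -> c <= y <= d -> modC (x +i* y) < rs + e -> 0 < u (x +i* y).
  have : P (-1) 1 (-1) 1.
    apply: (@quadrisection R P); [lra|lra| |].
      move=> a b c d ab cd [e1 e10 h1] [e2 e20 h2] [e3 e30 h3] [e4 e40 h4].
      exists (Num.min (Num.min e1 e2) (Num.min e3 e4)).
        by rewrite !lt_min e10 e20 e30.
      move=> x y /andP[x1 x2] /andP[y1 y2].
      rewrite -ltrBlDl !lt_min => /andP[/andP[m1 m2] /andP[m3 m4]].
      rewrite !ltrBlDl in m1 m2 m3 m4.
      have [xm|/ltW xm] := leP x ((a + b) / 2); have [ym|/ltW ym] := leP y ((c + d) / 2).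
      - by apply: h1; rewrite ?x1 ?y1.
      - by apply: h3; rewrite ?x1 ?y2 ?ym.
      - by apply: h2; rewrite ?x2 ?y1 ?xm.
      - by apply: h4; rewrite ?x2 ?y2 ?xm ?ym.
    move=> x y _ _; set z := x +i* y.
    have near (x' y' d : R) a b c e : a <= x <= b -> c <= y <= e ->
        (b - a) + (e - c) < d -> a <= x' <= b -> c <= y' <= e ->
        exists2 h, modC h < d & x' +i* y' = z + h.
      move=> /andP[q1 q2] /andP[q3 q4] q5 /andP[q6 q7] /andP[q8 q9].
      exists ((x' - x) +i* (y' - y)); last by apply: complex_ext => /=; ring.
      apply: le_lt_trans q5; rewrite (le_trans (modC_le_ReIm _)) //= lerD //;
        by rewrite ler_norml; apply/andP; split; lra.
    (* Inside, continuity gives [u > 0] near [z], and any margin such as 1 will do. Outside, no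
       point near [z] lies within the margin, so the claim is vacuous. *)
    have [zr|zr] := leP (modC z) rs.
      have uz := N' z zr.
      have [d d0 hd] := cu z (le_lt_trans zr rs1) _ uz.
      exists d => // a b c e /andP[_ q1] /andP[q2 _] /andP[_ q3] /andP[q4 _] q5.
      exists 1 => // x' y' hx hy _.
      have [h hh ->] : exists2 h, modC h < d & x' +i* y' = z + h.
        by apply: (near x' y' d a b c e); rewrite ?q1 ?q2 ?q3 ?q4.
      have := hd h hh; rewrite ltr_norml => /andP[]; lra.
    exists ((modC z - rs) / 2); first lra.
    move=> a b c e /andP[_ q1] /andP[q2 _] /andP[_ q3] /andP[q4 _] q5.
    exists ((modC z - rs) / 2); first lra.
    move=> x' y' hx hy.
    have [h hh ->] : exists2 h, modC h < (modC z - rs) / 2 & x' +i* y' = z + h.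
      by apply: (near x' y' _ a b c e); rewrite ?q1 ?q2 ?q3 ?q4.
    have := modC_subl z (- h); rewrite opprK modCN; lra.
  move=> [e e0 he].
  have [_ [z [-> z1 uz]] zlt] := inf_adherent e0 (conj S0 Sb).
  have := Re_le_modC z; have := Im_le_modC z; rewrite !ler_norml.
  move=> /andP[i1 i2] /andP[r1 r2].
  have := he (complex.Re z) (complex.Im z).
  have -> : complex.Re z +i* complex.Im z = z by case: (z).
  have -> : -1 <= complex.Re z <= 1 by apply/andP; split; lra.
  have -> : -1 <= complex.Im z <= 1 by apply/andP; split; lra.
  by move=> /(_ isT isT zlt); lra.
have z01 : modC z0 < 1 by exact: le_lt_trans z0r rs1.
have z0E : modC z0 = rs.
  by apply/eqP; rewrite eq_le z0r /=; exact: rsle.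
have m0 : 0 < modC z0.
  rewrite modC_gt0; apply/eqP => E; move: uz0; rewrite E; lra.
have unn z : modC z <= modC z0 -> 0 <= u z.
  rewrite z0E le_eqVlt => /orP[/eqP zE|/upos/ltW //].
  rewrite leNgt; apply/negP => uz.
  have z1 : modC z < 1 by rewrite zE.
  have uz' : 0 < - u z by rewrite oppr_gt0.
  have [d d0 hd] := cu z z1 _ uz'.
  (* Scaling [z] by [1 - t] enters the open disk where [u > 0], while staying within [d] of [z],
     where [u] would be negative. *)
  pose t := Num.min (1 / 2) (d / 2).
  have t0 : 0 < t by rewrite lt_min !divr_gt0.
  have t1 : t <= 1 / 2 by rewrite ge_min lexx.
  have td : t <= d / 2 by rewrite ge_min lexx orbT.
  have h1 : modC (- (t%:C * z)) < d.
    rewrite modCN modCM modC_real gtr0_norm //.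
    apply: (@le_lt_trans _ _ t); last lra.
    by rewrite ler_piMr ?(ltW t0) // zE ltW.
  have := hd _ h1; have : 0 < u (z - t%:C * z).
    apply: upos; have -> : z - t%:C * z = (1 - t)%:C * z.
      by rewrite rmorphB rmorph1; ring.
    have tt : 0 < 1 - t by lra.
    rewrite modCM modC_real gtr0_norm // -zE gtr_pMl; first lra.
    by rewrite zE -z0E.
  by rewrite ltr_norml => H /andP[]; lra.
exists z0; split => //.
by apply/eqP; rewrite eq_le uz0 unn.
Qed.

End Holomorphic.

(** * The principal power of 1 - z *)

Section ComplexPower.
Local Open Scope classical_set_scope.
Variable R : realType.
Implicit Types z w : R[i].

Definition cexp z : R[i] := (expR (complex.Re z))%:C * expi (complex.Im z).

Lemma expiD (a b : R) : expi (a + b) = expi a * expi b.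
Proof.
by apply: complex_ext; rewrite !ReImE /= ?cosD ?sinD //; ring.
Qed.

Lemma cexpD z w : cexp (z + w) = cexp z * cexp w.
Proof. by rewrite /cexp ReD ImD expRD expiD rmorphM /=; ring. Qed.

Lemma cexp0 : cexp 0 = 1.
Proof. by rewrite /cexp /= expR0 expi0 mulr1. Qed.

Lemma modC_cexp z : modC (cexp z) = expR (complex.Re z).
Proof. by rewrite modCM modC_expi mulr1 modC_real gtr0_norm ?expR_gt0. Qed.

(** With [X = e^x - 1] and [Y = e^{iy} - 1], the increment [(1 + X) (1 + Y) - 1] is [X + Y + X Y]:
    the first two terms are handled by real derivatives, the product is quadratic in [h]. *)
Lemma cder_cexp0 : cder cexp 0 1.
Proof.
move=> e e0.
have e3 : 0 < e / 3 by lra.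
have rE : rder (fun s : R => (expR s)%:C) 0 1.
  apply/rderP; split; last exact: is_derive_cst.
  by have := is_derive_expR (0 : R); rewrite expR0.
have rI := rder_expi (0 : R); rewrite expi0 mulr1 in rI.
have [d1 d10 h1] := rE _ e3; have [d2 d20 h2] := rI _ e3.
have [d3 d30 h3] := rE _ ltr01; have [d4 d40 h4] := rI _ ltr01.
(* The bounds [|X| <= 2 |x|] and [|Y| <= 2 |y|] give [|X Y| <= 4 |h|^2], and [e / 12] turns this
   into [e / 3 * |h|]. *)
exists (Num.min (Num.min d1 d2) (Num.min (Num.min d3 d4) (e / 12))).
  by rewrite !lt_min d10 d20 d30 d40 /=; lra.
move=> h; rewrite !lt_min => /andP[/andP[hd1 hd2] /andP[/andP[hd3 hd4] he]].
have Reh := Re_le_modC h; have Imh := Im_le_modC h.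
set x := complex.Re h in Reh; set y := complex.Im h in Imh.
have {}h1 := h1 x (le_lt_trans Reh hd1); have {}h2 := h2 y (le_lt_trans Imh hd2).
have {}h3 := h3 x (le_lt_trans Reh hd3); have {}h4 := h4 y (le_lt_trans Imh hd4).
rewrite !add0r expR0 ?expi0 in h1 h2 h3 h4.
pose X := (expR x)%:C - 1; pose Y := expi y - 1.
have X2 : modC X <= 2 * `|x|.
  have -> : X = ((expR x)%:C - 1 - 1 * x%:C) + x%:C by rewrite /X; ring.
  by rewrite (le_trans (modCD _ _)) // modC_real; lra.
have Y2 : modC Y <= 2 * `|y|.
  have -> : Y = (expi y - 1 - 'i * y%:C) + 'i * y%:C by rewrite /Y; ring.
  by rewrite (le_trans (modCD _ _)) // modCM modCi modC_real; lra.
have -> : cexp (0 + h) - cexp 0 - 1 * h =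
   ((expR x)%:C - 1 - 1 * x%:C) + (expi y - 1 - 'i * y%:C) + X * Y.
  have -> : 1 * h = x%:C + 'i * y%:C by rewrite mul1r; exact: complexE.
  by rewrite add0r cexp0 /cexp -/x -/y /X /Y; ring.
have XY : modC (X * Y) <= e / 3 * modC h.
  rewrite modCM (@le_trans _ _ (2 * modC h * (2 * modC h))) //.
    by apply: ler_pM; rewrite ?modC_ge0 //; lra.
  have -> : 2 * modC h * (2 * modC h) = (4 * modC h) * modC h by ring.
  by rewrite ler_wpM2r ?modC_ge0 //; lra.
have a1 : e / 3 * `|x| <= e / 3 * modC h by rewrite ler_pM2l.
have a2 : e / 3 * `|y| <= e / 3 * modC h by rewrite ler_pM2l.
have := modCD ((expR x)%:C - 1 - 1 * x%:C + (expi y - 1 - 'i * y%:C)) (X * Y).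
have := modCD ((expR x)%:C - 1 - 1 * x%:C) (expi y - 1 - 'i * y%:C).
lra.
Qed.

Lemma cder_cexp z : cder cexp z (cexp z).
Proof.
have H : cder (fun w => cexp z * cexp (w - z)) z (cexp z * (1 * (1 - 0))).
  apply: cderZ; apply: (@cder_comp R (fun w => w - z)).
    by apply: cderB; [exact: cder_id|exact: cder_cst].
  by rewrite subrr; exact: cder_cexp0.
rewrite subr0 !mulr1 in H.
apply: (@cder_near R _ _ _ _ 1 ltr01 _ H) => h _.
by rewrite -cexpD; congr cexp; ring.
Qed.

Lemma Re_onem_gt0 w : modC w < 1 -> 0 < 1 - complex.Re w.
Proof. by move=> w1; have := Re_le_modC w; rewrite ler_norml => /andP[]; lra. Qed.

Lemma onem_neq0 w : modC w < 1 -> 1 - w != 0.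
Proof.
move=> w1; apply/eqP => E; have := Re_onem_gt0 w1.
by have := congr1 (@complex.Re R) E; rewrite !ReImE /=; lra.
Qed.

(* The principal logarithm of [1 - w] is obtained as the primitive [L] of
   [-1/(1 - w)]: then [exp L = 1 - w], and [Im L] cannot leave ]-pi/2, pi/2[
   because [Re (1 - w) > 0]. *)
Lemma ex_log_onem : exists L : R[i] -> R[i],
  (forall w, modC w < 1 -> cder L w (- (1 - w)^-1)) /\
  (forall w, modC w < 1 -> complex.Re (L w) = ln (modC (1 - w)) /\
                           complex.Im (L w) = Arg (1 - w)).
Proof.
have [|L [L0 dL]] := @ex_primitive_disk R (fun w => - (1 - w)^-1).
  move=> w w1; apply: (@cdiff_near R (fun w => (-1) / (1 - w)) _ w 1) => //.
    by move=> h _; rewrite mulN1r.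
  apply: cdiff_div; first exact: cdiff_cst.
    by apply: cdiffB; [exact: cdiff_cst|exact: cdiff_id].
  exact: onem_neq0.
exists L; split => //.
have cexpL w : modC w < 1 -> cexp (L w) = 1 - w.
  move=> w1; have n0 := onem_neq0 w1.
  (* This quotient has derivative zero, since [L' = -1/(1 - w)], and it equals 1 at 0. *)
  have : cexp (L w) / (1 - w) = cexp (L 0) / (1 - 0).
    apply: (@ball_cst R (fun w => cexp (L w) / (1 - w)) 1) => // u u1.
    have m0 := onem_neq0 u1.
    apply: cder_eq.
      apply: (@cder_div R (fun w => cexp (L w)) (fun w => 1 - w) u _ (0 - 1)) => //.
        exact: (cder_comp (dL u u1) (cder_cexp _)).
      by apply: cderB; [exact: cder_cst|exact: cder_id].
    by rewrite /=; field.
  rewrite L0 cexp0 subr0 divr1 => E.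
  by rewrite -[LHS](divfK n0) E mul1r.
have cosL w : modC w < 1 -> 0 < cos (complex.Im (L w)).
  move=> w1; have := Re_onem_gt0 w1.
  have -> : 1 - complex.Re w = complex.Re (cexp (L w)) by rewrite cexpL // !ReImE.
  by rewrite /cexp !ReImE /= mul0r subr0 pmulr_rgt0 ?expR_gt0.
have ImL w : modC w < 1 -> - (pi / 2) < complex.Im (L w) < pi / 2.
  move=> w1; pose v (t : R) := complex.Im (L (w * t%:C)).
  have tw (t : R) : 0 <= t <= 1 -> modC (w * t%:C) < 1.
    move=> /andP[t0 t1]; rewrite modCM modC_real ger0_norm //.
    by apply: le_lt_trans w1; rewrite ler_piMr ?modC_ge0.
  have cv : {within `[0, 1], continuous v}.
    apply: derivable_within_continuous => t; rewrite in_itv /= => ht.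
    by have /rderP[_ []] := rder_comp (dL _ (tw _ ht)) (rder_line w t).
  have v0 : v 0 = 0 by rewrite /v mulr0 L0.
  have v1 : v 1 = complex.Im (L w) by rewrite /v mulr1.
  have p0 : 0 < pi / 2 :> R by rewrite divr_gt0 ?pi_gt0.
  rewrite -v1; apply/andP; split; rewrite ltNge; apply/negP => H.
    have [|t] := @IVT R v 0 1 (- (pi / 2)) ler01 cv.
      by rewrite v0; case: (leP 0 (v 1)) => ?; apply/andP; split; lra.
    rewrite in_itv /= => ht E; have := cosL _ (tw t ht).
    by rewrite -/(v t) E cosN cos_pihalf ltxx.
  have [|t] := @IVT R v 0 1 (pi / 2) ler01 cv.
    by rewrite v0; case: (leP 0 (v 1)) => ?; apply/andP; split; lra.
  rewrite in_itv /= => ht E; have := cosL _ (tw t ht).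
  by rewrite -/(v t) E cos_pihalf ltxx.
move=> w w1; split.
  by rewrite -cexpL // modC_cexp expRK.
(* A positive real part selects the [atan] branch of [Arg], and [atan] inverts [tan] on the range
   found for [Im L]. *)
have A0 : 0 < ReC (1 - w) by rewrite /ReC !ReImE /=; exact: Re_onem_gt0.
rewrite /Arg A0 -cexpL // /ReC /ImC /cexp !ReImE /= !mul0r subr0 addr0.
rewrite -mulf_div divff ?gt_eqF ?expR_gt0 // mul1r -/(tan _) tanK //.
by rewrite in_itv /= ImL.
Qed.

Lemma cder_cpow_onem (beta : R) w : modC w < 1 ->
  cder (fun u => cpow (1 - u) beta) w (- beta%:C * cpow (1 - w) beta / (1 - w)) /\
  cpow (1 - w) beta != 0.
Proof.
have [L [dL LE]] := ex_log_onem.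
have cE u : modC u < 1 -> cpow (1 - u) beta = cexp (beta%:C * L u).
  move=> u1; rewrite /cpow (negbTE (onem_neq0 u1)) /cexp !ReImE /= !mul0r subr0 addr0.
  have [-> ->] := LE u u1; rewrite /powR ifF //.
  by rewrite modC_eq0; exact/negbTE/onem_neq0.
move=> w1; split; last by rewrite cE // -modC_gt0 modC_cexp expR_gt0.
apply: (@cder_near R (fun u => cexp (beta%:C * L u)) _ w _ (1 - modC w)).
- by rewrite subr_gt0.
- by move=> h hh; rewrite cE // (le_lt_trans (modCD _ _)) //; lra.
apply: cder_eq.
  apply: (@cder_comp R (fun u => beta%:C * L u)); last exact: cder_cexp.
  by apply: cderZ; exact: dL.
by rewrite cE //; field; exact: onem_neq0.
Qed.

Lemma cpow1 (beta : R) : cpow (1 : R[i]) beta = 1.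
Proof.
rewrite /cpow oner_eq0 modC1 powR1 mul1r /Arg /ReC /ImC /= ltr01 mul0r atan0 mulr0.
exact: expi0.
Qed.

End ComplexPower.

(** * Convex and close-to-convex functions *)

Section Boundary.
Variable R : realType.
Implicit Types (f w : R[i] -> R[i]) (z : R[i]).

(** The window ]-1, 0[ is chosen for dilations: there the factor [1 + s] stays in ]0, 1[. *)
Lemma is_derive_le0_left (k : R -> R) (x m : R) : is_derive x 1 k m ->
  k x = 0 -> (forall s, -1 < s < 0 -> 0 <= k (x + s)) -> m <= 0.
Proof.
move=> /is_derive_realP H k0 Hk; apply/ler_addgt0Pl => e e0; rewrite addr0.
have [d d0 hd] := H e e0.
pose s := Num.min (1 / 2) (d / 2).
have s0 : 0 < s by rewrite lt_min !divr_gt0.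
have s1 : s <= 1 / 2 by rewrite ge_min lexx.
have sd : s <= d / 2 by rewrite ge_min lexx orbT.
have h1 : `|- s| < d by rewrite normrN gtr0_norm //; lra.
have h2 : 0 <= k (x + - s) by apply: Hk; apply/andP; split; lra.
have := hd _ h1; rewrite k0 subr0 normrN (gtr0_norm s0) ler_norml => /andP[_ hh].
by rewrite -(ler_pM2r s0); lra.
Qed.

Lemma is_derive_ge0_right (k : R -> R) (x m : R) : is_derive x 1 k m ->
  k x = 0 -> (forall s, 0 < s < 1 -> 0 <= k (x + s)) -> 0 <= m.
Proof.
move=> /is_derive_realP H k0 Hk; apply/ler_addgt0Pl => e e0.
have [d d0 hd] := H e e0.
pose s := Num.min (1 / 2) (d / 2).
have s0 : 0 < s by rewrite lt_min !divr_gt0.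
have s1 : s <= 1 / 2 by rewrite ge_min lexx.
have sd : s <= d / 2 by rewrite ge_min lexx orbT.
have h1 : `|s| < d by rewrite gtr0_norm //; lra.
have h2 : 0 <= k (x + s) by apply: Hk; apply/andP; split; lra.
have := hd _ h1; rewrite k0 subr0 (gtr0_norm s0) ler_norml => /andP[_ hh].
by rewrite -(ler_pM2r s0) mul0r mulrDl; lra.
Qed.

(** The squared modulus is differentiable even at zeros; its derivative is twice the real part of
    [conj(phi) phi']. *)
Lemma is_derive_modC_sqr (phi : R -> R[i]) (t : R) l : rder phi t l ->
  is_derive t 1 (fun s => modC (phi s) ^+ 2)
    (2 * (complex.Re (phi t) * complex.Re l + complex.Im (phi t) * complex.Im l)).
Proof.
move=> /rderP[dr di].
have -> : (fun s => modC (phi s) ^+ 2) =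
  (fun s => complex.Re (phi s)) * (fun s => complex.Re (phi s)) +
  (fun s => complex.Im (phi s)) * (fun s => complex.Im (phi s)).
  by apply/funext => s; rewrite modC_sqr !expr2.
have := is_deriveD (is_deriveM dr dr) (is_deriveM di di).
move=> H; apply: (is_derive_eq H).
by rewrite /GRing.scale /=; ring.
Qed.

Lemma rder_rotate f z l : cder f z l ->
  rder (fun s => f (z * expi s)) 0 (l * (z * 'i)).
Proof.
move=> H; apply: (@rder_comp R f (fun s => z * expi s)).
  by rewrite expi0 mulr1.
by apply: rderZ; have := rder_expi (0 : R); rewrite expi0 mulr1.
Qed.

Lemma rder_dilate f z l : cder f z l -> rder (fun s : R => f (z * s%:C)) 1 (l * z).
Proof.
move=> H; apply: (@rder_comp R f (fun s : R => z * s%:C)).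
  by rewrite mulr1.
exact: rder_line.
Qed.

(** On the circle through [z0] the modulus of [w] is maximal, so its tangential derivative vanishes
    and [z w'/w] is real; along the radius Schwarz's lemma forces growth at rate at least 1. *)
Lemma jack w (z0 w1 : R[i]) : (forall z, modC z < 1 -> cdiff w z) -> w 0 = 0 ->
  0 < modC z0 -> modC z0 < 1 -> modC (w z0) = 1 ->
  (forall z, modC z <= modC z0 -> modC (w z) <= 1) -> cder w z0 w1 ->
  exists2 m : R, 1 <= m & z0 * w1 = m%:C * w z0.
Proof.
move=> dw w0 z00 z01 wz0 wle dw1.
have w2 : complex.Re (w z0) ^+ 2 + complex.Im (w z0) ^+ 2 = 1.
  by rewrite -modC_sqr wz0 expr1n.
have dr := is_derive_modC_sqr (rder_rotate dw1).
have dd := is_derive_modC_sqr (rder_dilate dw1).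
rewrite expi0 mulr1 in dr; rewrite mulr1 in dd.
set A := w z0 in wz0 w2 dr dd *.
have -> : z0 * w1 = w1 * z0 by rewrite mulrC.
set B := w1 * z0 in dd *.
rewrite mulrA -/B in dr; clearbody B.
have dr' := is_deriveB (is_derive_cst (1 : R) (0 : R) 1) dr.
have k1 s : 0 <= 1 - modC (w (z0 * expi s)) ^+ 2.
  by rewrite subr_ge0 expr_le1 ?modC_ge0 // wle // modCM modC_expi mulr1.
have k0 : 1 - modC (w (z0 * expi 0)) ^+ 2 = 0.
  by rewrite expi0 mulr1 -/A wz0 expr1n subrr.
(* Nonnegativity on both sides of angle 0 makes the tangential derivative both nonpositive and
   nonnegative. *)
have t1 := is_derive_le0_left dr' k0 (fun s _ => k1 (0 + s)).
have t2 := is_derive_ge0_right dr' k0 (fun s _ => k1 (0 + s)).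
have dd' := is_deriveB (is_deriveM (is_derive_id (1 : R) (1 : R)) (is_derive_id (1 : R) (1 : R))) dd.
have j0 : 1 * 1 - modC (w (z0 * 1%:C)) ^+ 2 = 0.
  by rewrite !mulr1 -/A wz0 expr1n subrr.
(* Schwarz's lemma on radius [modC z0] gives [|w((1 + s) z0)| <= 1 + s], with equality at [s = 0];
   comparing derivatives yields [1 <= m]. *)
have j1 s : -1 < s < 0 -> 0 <= (1 + s) * (1 + s) - modC (w (z0 * (1 + s)%:C)) ^+ 2.
  move=> /andP[s1 s2]; have sp : 0 < 1 + s by lra.
  have zs : modC (z0 * (1 + s)%:C) = modC z0 * (1 + s).
    by rewrite modCM modC_real gtr0_norm.
  rewrite subr_ge0 -expr2 ler_sqr ?nnegrE ?modC_ge0 ?(ltW sp) //.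
  have := @schwarz R w (modC z0) 1 (z0 * (1 + s)%:C) z00 z01 dw w0.
  rewrite zs mulrAC divff ?gt_eqF // mul1r; apply.
    by move=> u uE; apply: wle; rewrite uE.
  by rewrite gtr_pMr //; lra.
have t3 := is_derive_le0_left dd' j0 j1.
rewrite /GRing.scale /= !mulr1 in t3.
rewrite !ReImE /= !mulr0 !mulr1 in t1 t2.
exists (complex.Re A * complex.Re B + complex.Im A * complex.Im B); first lra.
(* This says that [conj(A) B] is real; as [|A| = 1], it follows that [B] is this real number times
   [A]. *)
have t4 : complex.Im A * complex.Re B = complex.Re A * complex.Im B by lra.
apply: complex_ext; rewrite !ReImE /= mul0r ?subr0 ?addr0.
  rewrite mulrDl -[LHS]mul1r -w2 mulrDl.
  have -> : complex.Im A * complex.Im B * complex.Re A =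
    complex.Im A * (complex.Re A * complex.Im B) by ring.
  by rewrite -t4; ring.
rewrite mulrDl -[LHS]mul1r -w2 mulrDl.
have -> : complex.Re A * complex.Re B * complex.Im A =
  complex.Re A * (complex.Im A * complex.Re B) by ring.
by rewrite t4; ring.
Qed.

Lemma ucont_modC f z : ccont f z -> ucont (fun u => 1 - modC (f u)) z.
Proof.
move=> cf e e0; have [d d0 hd] := cf e e0; exists d => // h /hd; apply: le_lt_trans.
have -> : 1 - modC (f (z + h)) - (1 - modC (f z)) = modC (f z) - modC (f (z + h)) by ring.
have a := modC_subl (f z) (f (z + h)); have b := modC_subl (f (z + h)) (f z).
rewrite modCBC in a; rewrite ler_norml; apply/andP; split; lra.
Qed.

Lemma ucont_Re f z : ccont f z -> ucont (fun u => complex.Re (f u)) z.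
Proof.
move=> cf e e0; have [d d0 hd] := cf e e0; exists d => // h /hd; apply: le_lt_trans.
by rewrite -ReN -ReD; exact: Re_le_modC.
Qed.

(* [Re (z g'/g) > 1/2] is [|w| < 1] for [w = 1 - g/(z g')].  At a first point
   with [|w| = 1], Jack's lemma gives [z w' = m w] with [m >= 1], and then
   [1 + z g''/g' = (1 + z w')/(1 - w)] has real part [(1 - m)/2 <= 0]. *)
Lemma marx_strohhacker (g g1 g2 p w : R[i] -> R[i]) :
  (forall z, modC z < 1 -> cder g z (g1 z)) ->
  (forall z, modC z < 1 -> cder g1 z (g2 z)) ->
  (forall z, modC z < 1 -> g1 z != 0) ->
  (forall z, modC z < 1 -> 0 < complex.Re (1 + z * g2 z / g1 z)) ->
  (forall z, modC z < 1 -> cdiff p z) ->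
  (forall z, g z = z * p z) -> p 0 = g1 0 ->
  (forall z, w z = 1 - p z / g1 z) ->
  forall z, modC z < 1 -> modC (w z) < 1.
Proof.
move=> dg dg1 g1n Hg dp gp p0 wE.
have dw z : modC z < 1 -> cdiff w z.
  move=> z1; apply: (@cdiff_near R (fun z => 1 - p z / g1 z) w z 1) => //.
  apply: cdiffB; first exact: cdiff_cst.
  by apply: cdiff_div; [exact: dp|exists (g2 z); exact: dg1|exact: g1n].
have w0 : w 0 = 0 by rewrite wE p0 divff ?subrr // g1n // modC0.
move=> z z1; rewrite ltNge; apply/negP => wz.
have [|||z0 [z00 z01 u0 upos]] := @first_zero R (fun u => 1 - modC (w u)).
- by move=> u u1; apply/ucont_modC/cdiff_ccont/dw.
- by rewrite w0 modC0; lra.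
- by exists z => //; lra.
have wz0 : modC (w z0) = 1 by lra.
have wle u : modC u <= modC z0 -> modC (w u) <= 1.
  by move=> /upos; rewrite subr_ge0.
have [w1 dw1] := dw z0 z01.
have [m m1 mE] := jack dw w0 z00 z01 wz0 wle dw1.
have n0 := g1n z0 z01.
have pE : forall u, modC u < 1 -> p u = g1 u * (1 - w u).
  by move=> u u1; rewrite wE opprB addrC subrK mulrC divfK // g1n.
have dp0 : cder p z0 (g2 z0 * (1 - w z0) + g1 z0 * (0 - w1)).
  apply: (@cder_near R (fun u => g1 u * (1 - w u)) p z0 _ (1 - modC z0)).
  - by rewrite subr_gt0.
  - by move=> h hh; rewrite pE // (le_lt_trans (modCD _ _)) //; lra.
  apply: cderM; first exact: dg1.
  by apply: cderB; [exact: cder_cst|].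
(* Differentiating [g = z p] with [p = g1 (1 - w)] links [g''] to [w'] at [z0]. *)
have E : g1 z0 = 1 * p z0 + z0 * (g2 z0 * (1 - w z0) + g1 z0 * (0 - w1)).
  apply: (@cder_unique R g z0); first exact: dg.
  apply: (@cder_near R (fun u => u * p u) g z0 _ 1) => //.
  by apply: (@cderM R id p); first exact: cder_id.
pose Q := 1 + z0 * g2 z0 / g1 z0.
have EQ : (1 - w z0) * Q = 1 + m%:C * w z0.
  rewrite -mE /Q; apply: (mulfI n0).
  transitivity (g1 z0 * (1 - w z0) + z0 * g2 z0 * (1 - w z0)); first by field.
  move: E; rewrite pE // => /eqP; rewrite -subr_eq0 => /eqP E.
  apply/eqP; rewrite -subr_eq0; apply/eqP; rewrite -[RHS]oppr0 -E; ring.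
have Q0 : 0 < complex.Re Q by exact: Hg.
clearbody Q.
have := congr1 (@complex.Re R) EQ; have := congr1 (@complex.Im R) EQ.
have : complex.Re (w z0) ^+ 2 + complex.Im (w z0) ^+ 2 = 1.
  by rewrite -modC_sqr wz0 expr1n.
rewrite !ReImE /= !mul0r ?subr0 ?addr0 ?add0r ?oppr0.
set a := complex.Re (w z0); set b := complex.Im (w z0).
move: (complex.Re Q) Q0 (complex.Im Q) => c c0 d ab E2 E1.
have a1 : a <= 1.
  by rewrite -wz0 (le_trans (ler_norm _)) // Re_le_modC.
(* The real part of [EQ] multiplied by [conj(1 - w)], using [|1 - w|^2 = 2 (1 - a)] on the unit
   circle. *)
have K : 2 * (1 - a) * c = (1 - m) * (1 - a).
  have h1 : (1 - a) * ((1 - a) * c - - b * d) = (1 - a) * (1 + m * a) by rewrite E1.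
  have h2 : b * ((1 - a) * d + - b * c) = b * (m * b) by rewrite E2.
  nra.
(* If [a = 1] then [w = 1], and [EQ] reads [0 = 1 + m], impossible for [m >= 1]. *)
have [a1'|a1'] := eqVneq a 1; last first.
  have a2 : 0 < 1 - a by rewrite subr_gt0 lt_neqAle a1' a1.
  have : 0 < 2 * (1 - a) * c by rewrite !mulr_gt0.
  have : (1 - m) * (1 - a) <= 0 by apply: mulr_le0_ge0; lra.
  by rewrite K; lra.
have b0 : b = 0.
  by move: ab; rewrite a1' expr1n => /eqP; rewrite addrC -subr_eq0 addrK sqrf_eq0 => /eqP.
by move: E1; rewrite a1' b0; nra.
Qed.

(* Libera's lemma: at a first zero of [Re P], the derivative [z P'] is real
   and nonpositive, so [Re (P + lambda z P')] cannot be positive there. *)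
Lemma libera (P P1 lam : R[i] -> R[i]) :
  (forall z, modC z < 1 -> cder P z (P1 z)) ->
  (forall z, modC z < 1 -> 0 < complex.Re (lam z)) ->
  0 < complex.Re (P 0) ->
  (forall z, modC z < 1 -> 0 < complex.Re (P z + z * P1 z * lam z)) ->
  forall z, modC z < 1 -> 0 < complex.Re (P z).
Proof.
move=> dP lam0 P0 H z z1; rewrite ltNge; apply/negP => Pz.
have [|||z0 [z00 z01 u0 upos]] := @first_zero R (fun u => complex.Re (P u)) => //.
- by move=> u u1; apply/ucont_Re/cder_continuous/dP.
- by exists z.
have /rderP[dr _] := rder_rotate (dP z0 z01).
have /rderP[dd _] := rder_dilate (dP z0 z01).
have k1 s : 0 <= complex.Re (P (z0 * expi s)).
  by apply: upos; rewrite modCM modC_expi mulr1.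
have k0 : complex.Re (P (z0 * expi 0)) = 0 by rewrite expi0 mulr1.
have t1 := is_derive_le0_left dr k0 (fun s _ => k1 (0 + s)).
have t2 := is_derive_ge0_right dr k0 (fun s _ => k1 (0 + s)).
have j0 : complex.Re (P (z0 * 1%:C)) = 0 by rewrite mulr1.
have j1 s : -1 < s < 0 -> 0 <= complex.Re (P (z0 * (1 + s)%:C)).
  move=> /andP[s1 s2]; apply: upos; have sp : 0 < 1 + s by lra.
  by rewrite modCM modC_real gtr0_norm // ler_piMr ?modC_ge0 //; lra.
have t3 := is_derive_le0_left dd j0 j1.
rewrite mulrA in t1 t2.
have := H z0 z01; rewrite (mulrC z0) ReD u0 add0r ReM.
set B := P1 z0 * z0 in t1 t2 t3 *; clearbody B.
rewrite ReM /= in t1 t2.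
have B0 : complex.Im B = 0 by lra.
rewrite B0 mul0r subr0 => Hp.
have := lam0 z0 z01 => l0.
have : complex.Re B * complex.Re (lam z0) <= 0 by rewrite pmulr_lle0.
lra.
Qed.

End Boundary.

(** * From the relation [cder] to [cderiv], and final estimates *)

Section Bridge.
Variable R : realType.
Implicit Types (f g : R[i] -> R[i]) (z : R[i]).
Local Notation C := (R[i])^o.

Lemma cder_cderiv f z l : cder f z l -> cderiv (f : C -> C) z = l.
Proof. by move=> /is_derive_cderP H; exact: derive_val. Qed.

Lemma cder_derivable f z l : cder f z l -> derivable (f : C -> C) (z : C) (1 : C).
Proof. by move=> /is_derive_cderP H; exact: ex_derive. Qed.

Lemma derivable_cder f z : derivable (f : C -> C) (z : C) (1 : C) ->
  cder f z (cderiv (f : C -> C) z).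
Proof. by move=> H; apply/is_derive_cderP; exact: derivableP. Qed.

Lemma cdiff_cder f z : cdiff f z -> cder f z (cderiv (f : C -> C) z).
Proof. by move=> [l H]; rewrite (cder_cderiv H). Qed.

(** Serves to recover the derivative of the transform at 0, where its defining equation says
    nothing. *)
Lemma ccont_eq f g z (d : R) : 0 < d -> ccont f z -> ccont g z ->
  (forall h, modC h < d -> h != 0 -> f (z + h) = g (z + h)) -> f z = g z.
Proof.
move=> d0 cf cg fg; apply/eqP; rewrite -subr_eq0 -modC_eq0 eq_le modC_ge0 andbT.
apply/ler_addgt0Pl => e e0; rewrite addr0; have e2 : 0 < e / 2 by lra.
have [d1 d10 h1] := cf _ e2; have [d2 d20 h2] := cg _ e2.
pose h := (Num.min d (Num.min d1 d2) / 2)%:C.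
have m0 : 0 < Num.min d (Num.min d1 d2) by rewrite !lt_min d0 d10.
have hm : modC h = Num.min d (Num.min d1 d2) / 2.
  by rewrite modC_real gtr0_norm // divr_gt0.
have hlt : modC h < Num.min d (Num.min d1 d2) by rewrite hm; lra.
have h0 : h != 0 by rewrite -modC_gt0 hm divr_gt0.
move: hlt; rewrite !lt_min => /and3P[hd /h1 {}h1 /h2 {}h2].
rewrite (fg h hd h0) in h1.
have -> : f z - g z = (g (z + h) - g z) - (g (z + h) - f z) by ring.
by rewrite (le_trans (modCB _ _)) //; lra.
Qed.

(** The Moebius map [1/(1 - z)] sends the disk onto this half-plane. It is applied both to [z] and
    to the function [w] of the Marx-Strohhacker step. *)
Lemma Re_inv_onem_gt z : modC z < 1 -> 1 / 2 < complex.Re (1 - z)^-1.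
Proof.
move=> z1; have A0 := Re_onem_gt0 z1.
have : modC z ^+ 2 < 1 by rewrite expr_lt1 ?modC_ge0.
rewrite modC_sqr; case: z A0 {z1} => a b /= A0 ab.
have D0 : 0 < (1 - a) ^+ 2 + (0 - b) ^+ 2.
  by rewrite ltr_wpDr ?sqr_ge0 // exprn_gt0.
by rewrite ltr_pdivlMr //; nra.
Qed.

End Bridge.

(** [is_Cbeta] is a relation that leaves [F] free off the disk, hence a claim about every such [F];
    the existence clause ensures that this claim is not vacuous. *)
Theorem theorem2p16 (R : realType) (beta : R) (hbeta : 0 <= beta <= 1)
  (f : (R[i])^o -> (R[i])^o) (hf : close_to_convex f) :
  (exists F : (R[i])^o -> (R[i])^o, is_Cbeta beta f F) /\
  (forall F : (R[i])^o -> (R[i])^o, is_Cbeta beta f F -> close_to_convex F).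
Proof.
case: hf => [[anf [f0 f1]] [g [[[ang [g0 g1]] [gn gc]] [alpha [ha hre]]]]].
pose f' : R[i] -> R[i] := cderiv f; pose g' : R[i] -> R[i] := cderiv g.
have df (z : R[i]) : modC z < 1 -> cder f z (f' z) by move=> /anf/derivable_cder.
have dg (z : R[i]) : modC z < 1 -> cder g z (g' z) by move=> /ang/derivable_cder.
pose g'' : R[i] -> R[i] := cderiv (cderiv g).
have dg' (z : R[i]) : modC z < 1 -> cder g' z (g'' z).
  by move=> z1; apply: cdiff_cder; exact: (cdiff_deriv dg).
have z01 : modC (0 : R[i]) < 1 by rewrite modC0.
have cdf (z : R[i]) : modC z < 1 -> cdiff f z by move=> /df; exists (f' z).
have cdg (z : R[i]) : modC z < 1 -> cdiff g z by move=> /dg; exists (g' z).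
have [pf [fE df0 dpf]] := @ex_quotient R f 1 ltr01 cdf f0.
have [p [gE dg0 dp]] := @ex_quotient R g 1 ltr01 cdg g0.
have pf0 : pf 0 = 1 by rewrite -f1; exact: cder_unique df0 (df 0 z01).
have p0 : p 0 = g' 0 by exact: cder_unique dg0 (dg 0 z01).
have p01 : p 0 = 1 by rewrite p0.
pose w z : R[i] := 1 - p z / g' z.
have w1 : forall z : R[i], modC z < 1 -> modC (w z) < 1.
  exact: (marx_strohhacker dg dg' gn gc dp gE p0 (fun z => erefl)).
(* Since [w] stays in the disk, [1 - w = p / g'] never vanishes: [g] has no zero besides 0. *)
have lamE z : 1 - w z = p z / g' z by rewrite /w opprB addrC subrK.
have pn z : modC z < 1 -> p z != 0.
  move=> z1; have := onem_neq0 (w1 z z1); rewrite lamE.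
  by apply: contraNneq => ->; rewrite mul0r.
pose pf' : R[i] -> R[i] := cderiv (pf : (R[i])^o -> (R[i])^o).
pose p' : R[i] -> R[i] := cderiv (p : (R[i])^o -> (R[i])^o).
have dpf' z : modC z < 1 -> cder pf z (pf' z) by move=> /dpf/cdiff_cder.
have dp' z : modC z < 1 -> cder p z (p' z) by move=> /dp/cdiff_cder.
have f'E z : modC z < 1 -> f' z = pf z + z * pf' z.
  move=> z1; rewrite -[pf z]mul1r; apply: (cder_unique (df z z1)).
  apply: (@cder_near R (fun u => u * pf u) f z _ 1) => //.
  by apply: (@cderM R id pf); [exact: cder_id|exact: dpf'].
have g'E z : modC z < 1 -> g' z = p z + z * p' z.
  move=> z1; rewrite -[p z]mul1r; apply: (cder_unique (dg z z1)).
  apply: (@cder_near R (fun u => u * p u) g z _ 1) => //.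
  by apply: (@cderM R id p); [exact: cder_id|exact: dp'].
(* Libera's lemma with weight [1 - w = g/(z g')], of positive real part: for [P = e^{i alpha} f/g]
   the combination [P + z P' g/(z g')] is [e^{i alpha} f'/g']. *)
have Ppos : forall z, modC z < 1 -> 0 < complex.Re (expi alpha * (pf z / p z)).
  apply: (@libera R (fun z => expi alpha * (pf z / p z))
    (fun z => expi alpha * ((pf' z * p z - pf z * p' z) / p z ^+ 2)) (fun z => 1 - w z)).
  - move=> z z1; apply: cderZ; apply: cder_div; [exact: dpf'|exact: dp'|exact: pn].
  - by move=> z z1; rewrite ReD ReN; exact/Re_onem_gt0/w1.
  - rewrite pf0 p01 divff ?oner_neq0 // mulr1 /=.
    by apply: cos_gt0_pihalf.
  move=> z z1; have := hre z z1; rewrite -/(f' z) -/(g' z) lamE f'E //.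
  have gz : g' z != 0 by exact: gn.
  have pz := pn z z1; rewrite g'E // in gz *.
  suff -> : expi alpha * (pf z / p z) +
      z * (expi alpha * ((pf' z * p z - pf z * p' z) / p z ^+ 2)) * (p z / (p z + z * p' z)) =
      expi alpha * (pf z + z * pf' z) / (p z + z * p' z) by [].
  by field; rewrite gz pz.
pose CP (z : R[i]) : R[i] := cpow (1 - z) beta.
have dCP z : modC z < 1 -> cder CP z (- beta%:C * CP z / (1 - z)).
  by move=> /(cder_cpow_onem beta)[].
have CPn z : modC z < 1 -> CP z != 0 by move=> /(cder_cpow_onem beta)[].
have CP0 : CP 0 = 1 by rewrite /CP subr0 cpow1.
(* The integrand of [C_beta[f]] with its singularity at 0 removed. *)
pose Phi z : R[i] := pf z / CP z.
have dPhi z : modC z < 1 -> cdiff Phi z.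
  move=> z1; apply: cdiff_div; [exact: dpf| |exact: CPn].
  by eexists; exact: dCP.
split.
  have [F [F0 dF]] := ex_primitive_disk dPhi.
  exists F; split; first by move=> z /dF/cder_derivable.
  split; first exact: F0.
  move=> z z1 zn; rewrite (cder_cderiv (dF z z1)) fE /Phi.
  have CPz := CPn z z1.
  by rewrite -/(CP z); field; rewrite CPz zn.
move=> F [anF [F0 FE]].
pose F' : R[i] -> R[i] := cderiv F.
have dF (z : R[i]) : modC z < 1 -> cder F z (F' z) by move=> /anF/derivable_cder.
have F'E z : modC z < 1 -> F' z = Phi z.
  have off u : modC u < 1 -> u != 0 -> F' u = Phi u.
    move=> u1 un; rewrite /F' FE // fE /Phi -/(CP u).
    by have CPu := CPn u u1; field; rewrite CPu un.
  move=> z1; have [->|zn] := eqVneq z 0; last exact: off.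
  (* [F'] is itself differentiable, hence continuous, so its value at 0 is the limit of the values
     prescribed off 0. *)
  apply: (@ccont_eq R F' Phi 0 1).
  - exact: ltr01.
  - by apply/cdiff_ccont/(cdiff_deriv dF).
  - exact/cdiff_ccont/dPhi.
  - by move=> h h1 hn; rewrite add0r; exact: off.
split.
  split; [exact: anF|split; first exact: F0].
  by rewrite -/(F' 0) F'E // /Phi pf0 CP0 divr1.
pose psi z : R[i] := p z / CP z.
have dpsi z : modC z < 1 ->
    cder psi z ((p' z * CP z - p z * (- beta%:C * CP z / (1 - z))) / CP z ^+ 2).
  by move=> z1; apply: cder_div; [exact: dp'|exact: dCP|exact: CPn].
have [|h [h0 dh]] := @ex_primitive_disk R psi.
  by move=> z /dpsi; exact: ex_intro.
have hE z : modC z < 1 -> cderiv (h : (R[i])^o -> (R[i])^o) z = psi z.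
  by move=> /dh/cder_cderiv.
exists h; split.
  split.
    split; first by move=> z /dh/cder_derivable.
    by split; [exact: h0|rewrite hE // /psi p01 CP0 divr1].
  split => z z1.
    by rewrite hE // mulf_neq0 ?invr_neq0 ?pn ?CPn.
  (* [cderiv h] is known to equal [psi] only inside the disk, so the derivative of [psi] is
     transferred locally. *)
  have dh2 := @cder_near R psi (cderiv (h : (R[i])^o -> (R[i])^o)) z _ (1 - modC z) _ _ (dpsi z z1).
  rewrite (cder_cderiv (dh2 _ _)); first last.
  - by move=> u uz; rewrite hE // (le_lt_trans (modCD _ _)) //; lra.
  - by rewrite subr_gt0.
  rewrite hE //.
  have zn := onem_neq0 z1; have CPz := CPn z z1; have pz := pn z z1.
  have gz : g' z != 0 by exact: gn.
  (* Logarithmic derivative of [h' = p (1 - z)^{-beta}]: [z p'/p] is [z g'/g - 1 = 1/(1 - w) - 1],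
     and the power contributes [beta z/(1 - z)]. *)
  have -> : 1 + z * ((p' z * CP z - p z * (- beta%:C * CP z / (1 - z))) / CP z ^+ 2) / psi z =
     (1 - w z)^-1 + beta%:C * ((1 - z)^-1 - 1).
    rewrite lamE invf_div g'E // /psi; field.
    by rewrite zn CPz pz -g'E // gz.
  (* Together these give more than [1/2 - beta/2]; strictness survives at [beta = 0] and [beta = 1]
     because [a1] is strict. *)
  have a1 := Re_inv_onem_gt (w1 z z1); have a2 := Re_inv_onem_gt z1.
  rewrite /ReC ReD ReM /= mul0r subr0 ReD /= .
  case/andP: hbeta => b0 b1; nra.
exists alpha; split; first exact: ha.
move=> z z1.
rewrite -/(F' z) F'E // hE //.
have CPz := CPn z z1; have pz := pn z z1.
have -> : expi alpha * Phi z / psi z = expi alpha * (pf z / p z).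
  by rewrite /Phi /psi; field; rewrite pz CPz.
exact: Ppos.
Qed.
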